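(* Let $N$ be even and $0\le k\le N$ even. Let $\{p_j(x)\}$ be monic polynomials with $p_j$ of degree $j$, and define $q_{2j}(x)=p_{2j}(x)$, $q_{2j+1}(x)=p_{N-1-2j}(x)$ for $0\le j\le N/2-1$. The generalised partition function of the real spherical ensemble is $$Z_{k,(N-k)/2}[u,v]_S=\frac{(-1)^{(N/2)(N/2-1)/2}}{2^{N(N-1)/2}}\,\Gamma((N+1)/2)^{N/2}\,\Gamma(N/2+1)^{N/2}\prod_{s=1}^N\frac1{\Gamma(s/2)^2}\;[\zeta^k]\,\mathrm{Pf}[\zeta^2\alpha_{j,l}+\beta_{j,l}]_{j,l=1,\dots,N},$$ where $[\zeta^k]$ denotes the coefficient of $\zeta^k$ and, with $e_a=e^{i\theta_a}$ and $\Omega$ the open unit disk, $$\alpha_{j,l}=-\frac i2\int_0^{2\pi}d\theta_1\,u(e_1)\tau(e_1)\int_0^{2\pi}d\theta_2\,u(e_2)\tau(e_2)\,q_{j-1}(e_1)q_{l-1}(e_2)\,\mathrm{sgn}(\theta_2-\theta_1),$$ $$\beta_{j,l}=\int_\Omega dw\,v(w)\,\tau(w)\,\tau\!\Big(\frac1{\bar w}\Big)\frac1{|w|^2}\left(q_{j-1}(w)q_{l-1}\Big(\frac1{\bar w}\Big)-q_{l-1}(w)q_{j-1}\Big(\frac1{\bar w}\Big)\right).$$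
   Context: Real spherical ensemble: $\mathbf{Y}=\mathbf{A}^{-1}\mathbf{B}$ with $\mathbf{A},\mathbf{B}$ independent $N\times N$ real matrices with independent standard Gaussian entries. Eigenvalues $z$ in the upper half-plane are transformed to $w$ in the unit disk by $z=\frac1i\frac{w-1}{w+1}$, real eigenvalues $\lambda$ to $e=e^{i\theta}$ with $\lambda=\tan(\theta/2)$. Put $$\tau(x)=x^{-(N-1)/2}\left[\frac1{\sqrt\pi}\int_{\left||x|^{-1}-|x|\right|/2}^\infty\frac{dt}{(1+t^2)^{N/2+1}}\right]^{1/2},\qquad x^{-(N-1)/2}:=|x|^{-(N-1)/2}e^{-i(N-1)\arg(x)/2},\ \arg x\in[0,2\pi).$$ The eigenvalue density in the sector of $k$ real eigenvalues is $$\mathcal{Q}(\mathbf{Y})=A_{k,N}\prod_{j=1}^k\tau(e_j)\prod_{s=k+1}^{(N+k)/2}\frac{\tau(w_s)\tau(1/\bar w_s)}{|w_s|^2}\;\prod_{j<p}(e_p-e_j)\prod_{j,s}(w_s-e_j)\Big(\frac1{\bar w_s}-e_j\Big)\prod_{a<b}(w_b-w_a)\Big(\frac1{\bar w_b}-\frac1{\bar w_a}\Big)\prod_{c,d}\Big(\frac1{\bar w_d}-w_c\Big),$$ with $j,p\in\{1,\dots,k\}$, $s,a,b,c,d\in\{k+1,\dots,(N+k)/2\}$, and $$A_{k,N}=\frac{(-1)^{\frac{N-k}{2}(\frac{N-k}{2}-1)/2+(N-k)k/2-k(k-1)/4}}{2^{(N(N-1)+k)/2}}\Gamma((N+1)/2)^{N/2}\Gamma(N/2+1)^{N/2}\prod_{j=1}^N\frac1{\Gamma(j/2)^2},\qquad(-1)^a:=e^{i\pi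 a}.$$ The generalised partition function is $$Z_{k,(N-k)/2}[u,v]_S=\frac1{((N-k)/2)!}\int_{0<\theta_1<\cdots<\theta_k<2\pi}d\theta_1\cdots d\theta_k\prod_{l=1}^k u(e_l)\int_{\Omega^{(N-k)/2}}dw_{k+1}\cdots dw_{(N+k)/2}\prod_{s}v(w_s)\;\mathcal{Q}(\mathbf{Y}),$$ for functions $u$ on the unit circle and $v$ on $\Omega$ such that the integrals converge; $dw$ is planar Lebesgue measure. *)

(* Defs.v *)
From HB Require Import structures.
From mathcomp Require Import all_boot all_order all_algebra perm.
From mathcomp Require Import all_classical all_reals all_analysis.
From mathcomp Require Import complex.

Set Implicit Arguments.
Unset Strict Implicit.
Unset Printing Implicit Defensive.

Import Order.TTheory GRing.Theory Num.Theory.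
Import numFieldNormedType.Exports.
Import ComplexField.Normc.

Local Open Scope classical_set_scope.
Local Open Scope complex_scope.
Local Open Scope ring_scope.

(* (mu \x nu) packaged as a sigma-finite measure: the canonical sigma-finite
   structure on \x is the one for subprobabilities. *)
Section sigma_finite_product.
Context d1 d2 (T1 : measurableType d1) (T2 : measurableType d2) (R : realType).
Variable mu : {sigma_finite_measure set T1 -> \bar R}.
Variable nu : {sigma_finite_measure set T2 -> \bar R}.

Definition prod_measure : set (T1 * T2) -> \bar R := (mu \x nu)%E.

HB.instance Definition _ := Measure.copy prod_measure (mu \x nu)%E.

Let prod_measure_sigma_finite : sigma_finite setT prod_measure.
Proof.
have /sigma_finiteP[F [TF ndF Foo]] := sigma_finiteT mu.
have /sigma_finiteP[G [TG ndG Goo]] := sigma_finiteT nu.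
exists (fun n => F n `*` G n).
  rewrite -setXTT TF TG predeqE => -[x y]; split.
    move=> [/= [n _ Fnx] [k _ Gky]]; exists (maxn n k) => //; split.
    - by move: x Fnx; exact/subsetPset/ndF/leq_maxl.
    - by move: y Gky; exact/subsetPset/ndG/leq_maxr.
  by move=> [n _ []/= ? ?]; split; exists n.
move=> k; have [? ?] := Foo k; have [? ?] := Goo k.
split; first exact: measurableX.
by rewrite /prod_measure product_measure1E// lte_mul_pinfty// ge0_fin_numE.
Qed.

HB.instance Definition _ := Measure_isSigmaFinite.Build _ _ _ prod_measure
  prod_measure_sigma_finite.

End sigma_finite_product.

Section product_measure_cons.
Context d (T : measurableType d) (R : realType).
Variable mu : {sigma_finite_measure set T -> \bar R}.
Variables (n : nat) (nu : {sigma_finite_measure set (n.-tuple T) -> \bar R}).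

Definition tcons (x : T * n.-tuple T) : n.+1.-tuple T := [tuple of x.1 :: x.2].

Lemma measurable_tcons : measurable_fun [set: T * n.-tuple T] tcons.
Proof. by apply: measurable_cons. Qed.

Definition cons_measure : set (n.+1.-tuple T) -> \bar R :=
  pushforward (prod_measure mu nu) tcons.

Let cons_measure0 : cons_measure set0 = 0%E.
Proof. by rewrite /cons_measure /pushforward preimage_set0 measure0. Qed.

Let cons_measure_ge0 A : (0 <= cons_measure A)%E.
Proof. exact: (measure_ge0 (prod_measure mu nu)). Qed.

Let cons_measure_sigma_additive : semi_sigma_additive cons_measure.
Proof.
move=> F mF tF mUF; rewrite /cons_measure /pushforward preimage_bigcup.
apply: measure_semi_sigma_additive.
- by move=> i; rewrite -[X in measurable X]setTI; exact: measurable_tcons.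
- apply/trivIsetP => /= i j _ _ ij; rewrite -preimage_setI.
  by move/trivIsetP : tF => /(_ _ _ _ _ ij) ->//; rewrite preimage_set0.
- by rewrite -preimage_bigcup -[X in measurable X]setTI; exact: measurable_tcons.
Qed.

HB.instance Definition _ := isMeasure.Build _ _ _ cons_measure
  cons_measure0 cons_measure_ge0 cons_measure_sigma_additive.

Let cons_measure_sigma_finite : sigma_finite setT cons_measure.
Proof.
have [F FT Foo] := sigma_finiteT (prod_measure mu nu).
pose g (t : n.+1.-tuple T) : T * n.-tuple T := (thead t, [tuple of behead t]).
have gK x : g (tcons x) = x.
  case: x => a s; rewrite /g /tcons theadE; congr pair.
  by apply: val_inj.
have mg : measurable_fun setT g.
  apply/measurable_fun_pairP; split; first exact: measurable_tnth.
  exact: measurable_behead.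
exists (fun i => g @^-1` F i).
  by rewrite -preimage_bigcup -FT preimage_setT.
move=> i; have [mF Foo'] := Foo i; split.
  by rewrite -[X in measurable X]setTI; exact: mg.
rewrite /cons_measure /pushforward -comp_preimage.
by rewrite (_ : g \o tcons = id) // funeqE => x /=; exact: gK.
Qed.

HB.instance Definition _ := Measure_isSigmaFinite.Build _ _ _ cons_measure
  cons_measure_sigma_finite.

End product_measure_cons.

(* The n-fold product of mu, on n-tuples. *)
Fixpoint power_measure d (T : measurableType d) (R : realType)
    (mu : {sigma_finite_measure set T -> \bar R}) (n : nat) :
    {sigma_finite_measure set (n.-tuple T) -> \bar R} :=
  if n is n'.+1 then cons_measure mu (power_measure mu n')
  else \d_([tuple] : 0.-tuple T).

Section complex_integral.
Context d (T : measurableType d) (R : realType).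
Variable mu : {measure set T -> \bar R}.

Definition cintegrable (D : set T) (f : T -> R[i]) : Prop :=
  mu.-integrable D (EFin \o (fun x => complex.Re (f x))) /\
  mu.-integrable D (EFin \o (fun x => complex.Im (f x))).

Definition cintegral (D : set T) (f : T -> R[i]) : R[i] :=
  (\int[mu]_(x in D) complex.Re (f x))%R +i* (\int[mu]_(x in D) complex.Im (f x))%R.

End complex_integral.

(* Only meaningful for even n. For even i < n, ordS i (cyclic successor in 'I_n)
   is i.+1, so the product is over the pairs (s 0, s 1), (s 2, s 3), etc. *)
Definition pfaffian (K : comUnitRingType) (n : nat) (A : 'M[K]_n) : K :=
  (2 ^ n./2 * (n./2)`!)%:R^-1 *
  \sum_(s : {perm 'I_n})
    (-1) ^+ s * \prod_(i < n | ~~ odd i) A (s i) (s (ordS i)).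

Section spherical_ensemble.
Variable R : realType.
Implicit Types (x w : R[i]) (t theta : R).

Definition Gamma (a : R) : R :=
  (\int[lebesgue_measure]_(t in `]0, +oo[) (t `^ (a - 1) * expR (- t)))%R.

(* e^(i t) *)
Definition expi t : R[i] := cos t +i* sin t.

(* (-1)^a := e^(i pi a) for real a *)
Definition signpow (a : R) : R[i] := expi (pi * a).

(* The argument in [0, 2 pi[; the value at 0 is immaterial. *)
Definition carg x : R :=
  if 0 <= complex.Im x then acos (complex.Re x / normc x) else 2 * pi - acos (complex.Re x / normc x).

(* x^(- (N - 1) / 2), with the branch given by carg *)
Definition branch_pow (N : nat) x : R[i] :=
  (normc x `^ (- ((N%:R - 1) / 2)))%:C * expi (- ((N%:R - 1) * carg x / 2)).

Definition tau (N : nat) x : R[i] :=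
  branch_pow N x *
  (Num.sqrt ((Num.sqrt pi)^-1 *
     (\int[lebesgue_measure]_(t in `[`|(normc x)^-1 - normc x| / 2, +oo[)
        ((1 + t ^+ 2) `^ (N%:R / 2 + 1))^-1)%R))%:C.

(* A_{k,N} *)
Definition dens_const (N k : nat) : R[i] :=
  let h := (N%:R - k%:R) / 2 in
  signpow (h * (h - 1) / 2 + (N%:R - k%:R) * k%:R / 2
           - k%:R * (k%:R - 1) / 4) *
  (Gamma ((N%:R + 1) / 2) `^ (N%:R / 2) * Gamma (N%:R / 2 + 1) `^ (N%:R / 2)
   / 2 `^ ((N%:R * (N%:R - 1) + k%:R) / 2)
   * \prod_(1 <= j < N.+1) (Gamma (j%:R / 2) ^+ 2)^-1)%:C.

(* Q(Y) in the sector of k real and m pairs of complex eigenvalues; N = k + 2m. *)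
Definition eig_density (N k m : nat) (e : 'I_k -> R[i]) (w : 'I_m -> R[i]) :
    R[i] :=
  dens_const N k
  * (\prod_(j < k) tau N (e j))
  * (\prod_(s < m) (tau N (w s) * tau N ((w s)^*)%C^-1 / `|w s| ^+ 2))
  * (\prod_(p < k) \prod_(j < k | (j < p)%N) (e p - e j))
  * (\prod_(j < k) \prod_(s < m) ((w s - e j) * (((w s)^*)%C^-1 - e j)))
  * (\prod_(b < m) \prod_(a < m | (a < b)%N)
       ((w b - w a) * (((w b)^*)%C^-1 - ((w a)^*)%C^-1)))
  * (\prod_(c < m) \prod_(d < m) (((w d)^*)%C^-1 - w c)).

(* The plane, with its Lebesgue measure, is R * R. *)
Definition plane := (measurableTypeR R * measurableTypeR R)%type.

Definition plane_measure : {sigma_finite_measure set plane -> \bar R} :=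
  prod_measure (@lebesgue_measure R) (@lebesgue_measure R).

Definition toC (z : plane) : R[i] := z.1 +i* z.2.

Definition Omega : set plane := [set z | normc (toC z) < 1].

Definition ordered_angles (k : nat) : set (k.-tuple (measurableTypeR R)) :=
  [set th | (forall l : 'I_k, 0 < tnth th l < 2 * pi) /\
            (forall j l : 'I_k, (j < l)%N -> tnth th j < tnth th l)].

Definition Omega_power (m : nat) : set (m.-tuple plane) :=
  [set z | forall s : 'I_m, Omega (tnth z s)].

(* Z_{k,(N-k)/2}[u,v]_S *)
Definition gen_partition (N k : nat) (u v : R[i] -> R[i]) : R[i] :=
  let m := ((N - k)./2)%N in
  ((m`!)%:R)^-1 *
  cintegral (power_measure (@lebesgue_measure R) k) (@ordered_angles k)
    (fun th =>
       (\prod_(l < k) u (expi (tnth th l))) *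
       cintegral (power_measure plane_measure m) (@Omega_power m)
         (fun z =>
            (\prod_(s < m) v (toC (tnth z s))) *
            eig_density N (fun l : 'I_k => expi (tnth th l))
                          (fun s : 'I_m => toC (tnth z s)))).

(* q_{2j} = p_{2j} and q_{2j+1} = p_{N-1-2j} *)
Definition qpol (N : nat) (p : nat -> {poly R[i]}) (i : nat) : {poly R[i]} :=
  if odd i then p (N - i)%N else p i.

Definition alpha_weight (N : nat) (u : R[i] -> R[i]) (q : {poly R[i]}) theta :
    R[i] :=
  u (expi theta) * tau N (expi theta) * q.[expi theta].

Definition beta_integrand (N : nat) (v : R[i] -> R[i]) (q q' : {poly R[i]})
    (z : plane) : R[i] :=
  let w := toC z in
  v w * tau N w * tau N (w^*)%C^-1 / `|w| ^+ 2 *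
  (q.[w] * q'.[(w^*)%C^-1] - q'.[w] * q.[(w^*)%C^-1]).

Definition alpha (N : nat) (u : R[i] -> R[i]) (q q' : {poly R[i]}) : R[i] :=
  - ('i%C / 2) *
  cintegral (@lebesgue_measure R) `[0, 2 * pi] (fun theta1 =>
    alpha_weight N u q theta1 *
    cintegral (@lebesgue_measure R) `[0, 2 * pi] (fun theta2 =>
      alpha_weight N u q' theta2 * (Num.sg (theta2 - theta1))%:C)).

Definition beta (N : nat) (v : R[i] -> R[i]) (q q' : {poly R[i]}) : R[i] :=
  cintegral plane_measure Omega (beta_integrand N v q q').

End spherical_ensemble.

(* Main.v *)
Require Import Defs.
From mathcomp Require Import all_boot all_order all_algebra perm.
From mathcomp Require Import all_classical all_reals all_analysis.
From mathcomp Require Import complex measurable_realfun.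
From mathcomp Require Import zify ring.

(* Write w' for 1/conj(w). With the points listed as e_1, ..., e_k, w_1, w'_1,
   w_2, w'_2, ... the product of differences in the density is a Vandermonde
   determinant up to sign, hence equal to det(q_l(x_i)) up to sign. Expanding
   over permutations of the N columns and antisymmetrising each pair (w_s, w'_s)
   makes the w-integrals factor into entries of beta. What remains is an
   alternating function of the angles; its integral over ordered angles is the
   full-space integral against sgn(th_2 - th_1) sgn(th_4 - th_3) ... divided by
   2^(k/2) (k/2)! (de Bruijn), which factors into entries of alpha. The same sum
   over permutations is the coefficient of zeta^k in Pf(zeta^2 alpha + beta),
   because a sum over pairings does not change when the pairs are permuted. *)

Set Implicit Arguments.
Unset Strict Implicit.
Unset Printing Implicit Defensive.

Import Order.TTheory GRing.Theory Num.Theory.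
Import numFieldNormedType.Exports.

Local Open Scope ring_scope.

(** * Alternating sums over pairs *)

(** Integrability shapes the order of the argument. Only the antisymmetrised integrands of beta are
    assumed integrable, not their two halves, so each pair (w_s, w'_s) is antisymmetrised inside the
    finite sum before any integral is split. The density itself is not assumed integrable: once
    expanded it is a finite sum of products of one-variable functions, and the only factors that
    couple variables are signs and indicators, which are bounded, so everything follows from the
    hypotheses on the entries. With k = 2r and N = 2(r + m), both sides reduce to one number:
    [alt_pairs] with the alpha-type matrix on the first r pairs and the beta matrix on the last m.
    The partition function reaches it through an integral, the Pfaffian through a choice of r pairs
    among r + m. What remains is to match the constants. Of the signs, the one from interleaving the
    points cancels against A_{k,N}, and the one from reordering the p's into the q's survives. *)

Fact ord_even_subproof n (i : 'I_n) : (i.*2 < n.*2)%N.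
Proof. by rewrite ltn_double. Qed.
Fact ord_odd_subproof n (i : 'I_n) : (i.*2.+1 < n.*2)%N.
Proof. by rewrite ltn_Sdouble. Qed.
Definition ord_even n (i : 'I_n) : 'I_n.*2 := Ordinal (ord_even_subproof i).
Definition ord_odd n (i : 'I_n) : 'I_n.*2 := Ordinal (ord_odd_subproof i).

Lemma ord_even_inj n : injective (@ord_even n).
Proof. by move=> i j /(congr1 val) /= /double_inj/val_inj. Qed.

Lemma ord_odd_inj n : injective (@ord_odd n).
Proof. by move=> i j /(congr1 val) /= [] /double_inj/val_inj. Qed.

Lemma ord_even_neq_odd n (i j : 'I_n) : ord_even i != ord_odd j.
Proof.
by apply/eqP => /(congr1 val) /= /(congr1 odd); rewrite /= !odd_double.
Qed.

Lemma prod_double (K : comPzRingType) n (F : 'I_n.*2 -> K) :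
  \prod_(j < n.*2) F j = \prod_(i < n) (F (ord_even i) * F (ord_odd i)).
Proof.
elim: n F => [|n IHn] F; first by rewrite !big_ord0.
rewrite !big_ord_recr /= IHn /= -mulrA; congr (_ * (_ * _)).
- by apply: eq_bigr => i _; congr (F _ * F _); apply: val_inj.
- by congr F; apply: val_inj.
- by congr F; apply: val_inj.
Qed.

Section AltPairs.
Variable K : comPzRingType.

(* An unnormalised Pfaffian with its own matrix at each pair of positions: it is
   multilinear in M, and both sides of the theorem are values of it. *)
Definition alt_pairs n (M : 'I_n -> 'M[K]_n.*2) : K :=
  \sum_(s : 'S_n.*2) (-1) ^+ s *
    \prod_(i < n) M i (s (ord_even i)) (s (ord_odd i)).

Lemma eq_alt_pairs n (M M' : 'I_n -> 'M[K]_n.*2) :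
  M =1 M' -> alt_pairs M = alt_pairs M'.
Proof.
move=> MM'; apply: eq_bigr => s _; congr (_ * _).
by apply: eq_bigr => i _; rewrite MM'.
Qed.

(** Exchanging two pairs takes two transpositions, one of even and one of odd positions. Their
    product is an even permutation, so this substitution in the sum costs no sign. *)
Lemma alt_pairs_tperm n (M : 'I_n -> 'M[K]_n.*2) (a b : 'I_n) :
  alt_pairs (fun i => M (tperm a b i)) = alt_pairs M.
Proof.
rewrite /alt_pairs (reindex_inj (mulgI (tperm (ord_even a) (ord_even b) * tperm
  (ord_odd a) (ord_odd b))%g)).
apply: eq_bigr => s _ /=.
rewrite !odd_permM !odd_tperm (inj_eq (@ord_even_inj n)) (inj_eq (@ord_odd_inj
  n)).
rewrite addbb addFb; congr (_ * _).
rewrite (reindex_inj (@perm_inj _ (tperm a b))) /=.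
apply: eq_bigr => i _; rewrite tpermK !permM.
suff [-> ->] : (tperm (ord_odd a) (ord_odd b) (tperm (ord_even a) (ord_even b)
  (ord_even (tperm a b i))) = ord_even i) /\
   (tperm (ord_odd a) (ord_odd b) (tperm (ord_even a) (ord_even b) (ord_odd
     (tperm a b i))) = ord_odd i) by [].
rewrite [tperm (ord_even a) _ (ord_odd _)]tpermD ?ord_even_neq_odd //.
rewrite -(inj_tperm _ _ _ (@ord_even_inj n)) tpermK tpermD ?[ord_odd _ ==
  _]eq_sym ?ord_even_neq_odd //.
by rewrite -(inj_tperm _ _ _ (@ord_odd_inj n)) tpermK.
Qed.

Lemma alt_pairs_perm n (M : 'I_n -> 'M[K]_n.*2) (t : 'S_n) :
  alt_pairs (fun i => M (t i)) = alt_pairs M.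
Proof.
case: (prod_tpermP t) => ts -> _ {t}.
elim: ts => [|t ts IH] in M *.
  by apply: eq_alt_pairs => i; rewrite big_nil perm1.
rewrite -[RHS]IH -[RHS](alt_pairs_tperm _ t.1 t.2).
by apply: eq_alt_pairs => i; rewrite big_cons permM.
Qed.

(** Exchanging the two positions of pair [a] changes the sign of every term and transposes [M a], so
    the subtracted transpose contributes the same sum again. *)
Lemma alt_pairs_asym1 n (M : 'I_n -> 'M[K]_n.*2) (a : 'I_n) :
  alt_pairs (fun i => if i == a then M a - (M a)^T else M i) =
  alt_pairs M *+ 2.
Proof.
pose rest (s : 'S_n.*2) := \prod_(i < n | i != a) M i (s (ord_even i)) (s
  (ord_odd i)).
have -> : alt_pairs (fun i => if i == a then M a - (M a)^T else M i) =
    alt_pairs M - \sum_(s : 'S_n.*2)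
      (-1) ^+ s * (M a (s (ord_odd a)) (s (ord_even a)) * rest s).
  rewrite /alt_pairs -sumrB; apply: eq_bigr => s _.
  rewrite -mulrBr; congr (_ * _).
  rewrite (bigD1 a) //= eqxx !mxE [X in _ = X - _](bigD1 a) //= -mulrBl.
  by congr (_ * _); apply: eq_bigr => i /negbTE ->.
rewrite mulr2n; congr (_ + _).
rewrite -sumrN (reindex_inj (mulgI (tperm (ord_even a) (ord_odd a)))).
apply: eq_bigr => s _ /=.
rewrite odd_permM odd_tperm ord_even_neq_odd signr_addb expr1 mulN1r mulNr
  opprK.
congr (_ * _); rewrite !permM tpermL tpermR [RHS](bigD1 a) //=; congr (_ * _).
apply: eq_bigr => i ia; rewrite !permM !tpermD // ?(inj_eq (@ord_even_inj n))
  ?(inj_eq (@ord_odd_inj n)) 1?eq_sym ?ord_even_neq_odd //.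
- by rewrite eq_sym ord_even_neq_odd.
Qed.

Lemma alt_pairs_asym n (M : 'I_n -> 'M[K]_n.*2) (P : {set 'I_n}) :
  alt_pairs (fun i => if i \in P then M i - (M i)^T else M i) =
  alt_pairs M *+ 2 ^ #|P|.
Proof.
have [k] := ubnP #|P|; elim: k P => // k IHk P /ltnSE-le_Pk.
have [->|[a aP]] := set_0Vmem P.
  by rewrite cards0 mulr1n; apply: eq_alt_pairs => i; rewrite inE.
have Pa : #|P| = #|P :\ a|.+1 by rewrite (cardsD1 a) aP.
rewrite Pa expnS mulnC mulrnA -IHk -?Pa// -(alt_pairs_asym1 _ a).
apply: eq_alt_pairs => i; rewrite !inE.
by have [->|] := eqVneq i a; rewrite ?aP ?eqxx.
Qed.

(** A permutation is determined by the image of the first index and the relabelled rest. Injectivity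
    is enough, since both sides have (n+1)! terms. *)
Lemma sum_lift_perm n (F : 'S_n.+1 -> K) :
  \sum_(s : 'S_n.+1) F s =
  \sum_(x < n.+1) \sum_(t : 'S_n) F (lift_perm ord0 x t).
Proof.
pose f (p : 'I_n.+1 * 'S_n) := lift_perm ord0 p.1 p.2.
have f_inj : injective f.
  move=> [x s] [y t] /= E; move: (congr1 (fun p : 'S_n.+1 => p ord0) E).
  rewrite /f /= !lift_perm_id => xy; subst y; congr pair.
  apply/permP => i; move: (congr1 (fun p : 'S_n.+1 => p (lift ord0 i)) E).
  by rewrite /f !lift_perm_lift => /lift_inj.
rewrite pair_bigA /= [LHS](reindex f) //.
apply/onW_bij/inj_card_bij => //.
by rewrite card_prod card_ord !card_Sn factS.
Qed.

Lemma sum_sign n : \sum_(i < n) (-1) ^+ i = (odd n)%:R :> K.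
Proof.
elim: n => [|n IHn]; first by rewrite big_ord0.
rewrite big_ord_recr /= IHn -signr_odd; case: (odd n) => /=.
  by rewrite expr1 subrr.
by rewrite expr0 add0r.
Qed.

Definition sgn_mx n : 'M[K]_n := \matrix_(i, j) ((i < j)%N%:R - (j < i)%N%:R).

Lemma sgn_mx_lift n (x : 'I_n.+1) (a b : 'I_n) :
  sgn_mx n.+1 (lift x a) (lift x b) = sgn_mx n a b.
Proof. by rewrite !mxE !ltnNge /= !leq_bump2. Qed.

(** The y below x enter with sign -1, the others with +1, so the sum is S_n - 2 S_x for the partial
    sums S of (-1)^y. Here n is odd, so S_n = 1, while S_x is 1 or 0 as x is odd or even. *)
Lemma sum_sgn_mx_lift n (x : 'I_n.+1) : ~~ odd n.+1 ->
  \sum_(y < n) (-1) ^+ y * sgn_mx n.+1 x (lift x y) = (-1) ^+ x.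
Proof.
rewrite /= negbK => n_odd.
have xn : (x <= n)%N by rewrite -ltnS.
transitivity (\sum_(0 <= y < n)
    (-1) ^+ y * ((x < bump x y)%N%:R - (bump x y < x)%N%:R) : K).
  by rewrite big_mkord; apply: eq_bigr => y _; rewrite !mxE.
rewrite (big_cat_nat (leq0n x) xn) /=.
rewrite (eq_big_nat _ _ (F2 := fun y => - (-1) ^+ y)); last first.
  move=> y /andP[_ yx]; have -> : bump x y = y by rewrite /bump leqNgt yx.
  rewrite yx ltnNge (ltnW yx) /=.
  by rewrite sub0r mulrN1.
rewrite [X in _ + X](eq_big_nat _ _ (F2 := fun y => (-1) ^+ y)); last first.
  move=> y /andP[xy _]; have -> : bump x y = y.+1 by rewrite /bump xy.
  rewrite ltnS xy ltnNge (leqW xy) /=.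
  by rewrite subr0 mulr1.
have := sum_sign n; rewrite -(big_mkord xpredT (fun y => (-1) ^+ y)).
rewrite (big_cat_nat (leq0n x) xn) /= n_odd => /(canRL (addKr _)) ->.
rewrite sumrN big_mkord sum_sign -[RHS]signr_odd.
by case: (odd x) => /=; rewrite ?expr1 ?expr0; ring.
Qed.

(* The normalised Pfaffian of (sgn(j - i)) is 1. Choosing the values x, y of the
   first pair of positions leaves the other entries unchanged, since lift is
   increasing, and the signed sum over y is (-1)^x. *)
Lemma alt_pairs_sgn n :
  alt_pairs (fun _ : 'I_n => sgn_mx n.*2) = (2 ^ n * n`!)%:R.
Proof.
elim: n => [|n IHn].
  rewrite /alt_pairs (eq_bigr (fun=> 1)) => [|s _].
    by rewrite sumr_const card_Sn.
  by rewrite big_ord0 mulr1 permS0 odd_perm1.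
transitivity (\sum_(s : 'S_n.*2.+2) (-1) ^+ s * \prod_(i < n.+1) sgn_mx n.*2.+2
  (s (ord_even i)) (s (ord_odd i))); first by [].
rewrite sum_lift_perm.
pose c : K := \sum_(x < n.*2.+2) (-1) ^+ x * \sum_(y < n.*2.+1) (-1) ^+ y *
  sgn_mx _ x (lift x y).
transitivity (c * (2 ^ n * n`!)%:R).
  rewrite -IHn mulr_suml; apply: eq_bigr => x _.
  rewrite sum_lift_perm -mulrA mulr_suml mulr_sumr; apply: eq_bigr => y _.
  rewrite !mulr_sumr; apply: eq_bigr => s _.
  rewrite !odd_lift_perm /= 2!signr_addb (signr_odd _ x) (signr_odd _ y)
    -!mulrA; congr (_ * (_ * _)).
  rewrite [RHS]mulrCA; congr (_ * _).
  rewrite big_ord_recl; congr (_ * _).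
    have -> : ord_even ord0 = ord0 :> 'I_n.*2.+2 by apply: val_inj.
    have -> : ord_odd ord0 = lift ord0 ord0 :> 'I_n.*2.+2 by apply: val_inj.
    by rewrite lift_perm_lift !lift_perm_id.
  apply: eq_bigr => i _.
  have -> : ord_even (lift ord0 i) =
    lift ord0 (lift ord0 (ord_even i)) :> 'I_n.*2.+2 by apply: val_inj.
  have -> : ord_odd (lift ord0 i) =
    lift ord0 (lift ord0 (ord_odd i)) :> 'I_n.*2.+2 by apply: val_inj.
  by rewrite !lift_perm_lift !sgn_mx_lift.
(* Each [x] contributes (-1)^x squared, so [c] counts the 2n + 2 values of the first position. *)
have -> : c = n.*2.+2%:R.
  rewrite /c (eq_bigr (fun=> 1)) ?sumr_const ?card_ord // => x _.
  by rewrite sum_sgn_mx_lift /= ?negbK ?odd_double // -expr2 sqrr_sign.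
rewrite -natrM; congr (_%:R); rewrite expnS factS -doubleS -mul2n; ring.
Qed.
End AltPairs.

(** Only the number of pairs carrying [A] matters: the patterns i \in J and i < r have equally many
    true entries, so a permutation of the pairs takes one to the other. *)
Lemma alt_pairs_set (K : comPzRingType) n r (A B : 'M[K]_n.*2)
    (J : {set 'I_n}) : #|J| = r ->
  alt_pairs (fun i => if i \in J then A else B) =
  alt_pairs (fun i : 'I_n => if (i < r)%N then A else B).
Proof.
move=> Jr; pose t := [tuple i \in J | i < n];
  pose t' := [tuple (i < r)%N | i < n].
have count_tnth (u : n.-tuple bool) : count id u =
  (\sum_(i < n | tnth u i) 1)%N.
  by rewrite -sum1_count big_tuple.
have count_t : count id t = r.
  by rewrite count_tnth -Jr -sum1_card; apply: eq_bigl => i;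
    rewrite tnth_mktuple.
have rn : (r <= n)%N by rewrite -Jr -[X in (_ <= X)%N]card_ord max_card.
have count_t' : count id t' = r.
  rewrite count_tnth; under eq_bigl do rewrite tnth_mktuple.
  by rewrite (big_ord_narrow rn) sum1_card card_ord.
have /tuple_permP[s ts] : perm_eq t t'.
  have cnt (u : n.-tuple bool) : count (predC id) u = (n - count id u)%N.
    by rewrite -[X in (X - _)%N](size_tuple u) -(count_predC id u) addKn.
  have cnt1 (u : n.-tuple bool) : count_mem true u = count id u.
    by apply: eq_count => -[].
  have cnt0 (u : n.-tuple bool) : count_mem false u = count (predC id) u.
    by apply: eq_count => -[].
  apply/allP => b _; apply/eqP.
  by case: b; rewrite ?cnt1 ?cnt0 ?cnt count_t count_t'.
rewrite -[RHS](alt_pairs_perm _ s); apply: eq_alt_pairs => i.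
have := congr1 (fun u => nth false u i) ts.
by rewrite -!tnth_nth !tnth_mktuple => ->.
Qed.
(** In the expanded product let [J] be the set of pairs that choose the X^2 A term; the degree is 2
    #|J|. The 'C(r + m, r) sets of size r all give the same value. *)
Lemma alt_pairs_coef (K : comNzRingType) r m (A B : 'M[K]_((r + m).*2)) :
  (alt_pairs (fun _ : 'I_(r + m) =>
     \matrix_(j, l) ('X^2 * (A j l)%:P + (B j l)%:P)))`_r.*2 =
  alt_pairs (fun i : 'I_(r + m) => if (i < r)%N then A else B) *+ 'C(r + m, r).
Proof.
set a := alt_pairs (fun i => if _ then A else B).
have -> : alt_pairs (fun _ : 'I_(r + m) =>
     \matrix_(j, l) ('X^2 * (A j l)%:P + (B j l)%:P)) =
  \sum_(J : {set 'I_(r + m)})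
     (alt_pairs (fun i => if i \in J then A else B))%:P * 'X^(#|J|.*2).
  rewrite [LHS]/alt_pairs; under eq_bigr => s _.
    under eq_bigr => i _ do rewrite mxE.
    rewrite bigA_distr /= mulr_sumr; over.
  rewrite exchange_big /=; apply: eq_bigr => J _.
  rewrite /alt_pairs rmorph_sum mulr_suml; apply: eq_bigr => s _.
  rewrite rmorphM rmorph_sign -mulrA; congr (_ * _).
  rewrite rmorph_prod (bigID (mem J)) /= [in RHS](bigID (mem J)) /=.
  rewrite mulrAC; congr (_ * _); last first.
    by apply: eq_bigr => i /negbTE ->.
  have -> : 'X^(#|J|.*2) = \prod_(i in J) 'X^2 :> {poly K}.
    by rewrite prodr_const -exprM mul2n.
  rewrite -big_split /=.
  by apply: eq_bigr => i ->; rewrite mulrC.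
rewrite coef_sum.
transitivity (\sum_(J : {set 'I_(r + m)} | #|J| == r) a).
  rewrite [RHS]big_mkcond /=; apply: eq_bigr => J _.
  rewrite coefCM coefXn (inj_eq double_inj) eq_sym.
  case: eqP => Jr; last by rewrite mulr0.
  by rewrite mulr1 (alt_pairs_set _ _ Jr).
by rewrite sumr_const -[X in 'C(X, _)]card_ord -card_draws cardsE.
Qed.

(* The reindexing of the p's by the q's: N - 1 - 2j = N - l for l = 2j + 1. *)
Fact flip_odd_subproof n (l : 'I_n.*2) :
  ((if odd l then n.*2 - l else l) < n.*2)%N.
Proof. by case: l => l ln /=; case: ifP => // ol; lia. Qed.

Definition flip_odd_fun n (l : 'I_n.*2) : 'I_n.*2 :=
  Ordinal (flip_odd_subproof l).

Lemma flip_odd_funK n : involutive (@flip_odd_fun n).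
Proof.
move=> [l ln]; apply: val_inj => /=; case ol : (odd l); rewrite /= ?ol //.
by rewrite oddB ?odd_double ?ol /=; lia.
Qed.

Definition flip_odd n : 'S_n.*2 := perm (can_inj (@flip_odd_funK n)).

Lemma val_flip_odd n (l : 'I_n.*2) :
  flip_odd n l = (if odd l then n.*2 - l else l)%N :> nat.
Proof. by rewrite permE. Qed.

Ltac bump_lia := rewrite ?oddD ?odd_double ?doubleS; repeat case: leqP => ?;
  simpl nat_of_bool; simpl addb; simpl negb; cbv iota; lia.

(* Up to fixed points, flip_odd n.+2 is flip_odd n and a transposition. *)
Lemma flip_oddSS n : flip_odd n.+2 = lift_perm ord0 ord0 (lift_perm ord0 ord_max
  (lift_perm ord_max ord0 (lift_perm ord_max ord_max (flip_odd n)))).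
Proof.
apply/permP => i; apply: ord_inj; rewrite val_flip_odd.
case: (unliftP ord0 i) => [i1|] ->; last by rewrite lift_perm_id.
rewrite lift_perm_lift; case: (unliftP ord0 i1) => [i2|] ->; last first.
  by rewrite lift_perm_id /= /bump -/double; bump_lia.
rewrite lift_perm_lift; case: (unliftP ord_max i2) => [i3|] ->; last first.
  by rewrite lift_perm_id /= /bump -/double odd_double; bump_lia.
rewrite lift_perm_lift; case: (unliftP ord_max i3) => [i4|] ->; last first.
  by rewrite lift_perm_id /= /bump -/double; bump_lia.
have bump_lt (a b : nat) : (b < a)%N -> bump a b = b.
  by move=> ba; rewrite /bump leqNgt ba.
rewrite lift_perm_lift /= val_flip_odd -/double; case: i4 => i4 /= i4_lt.
rewrite -/double in i4_lt *; have := flip_odd_subproof (Ordinal i4_lt) => /=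
  v_lt.
rewrite -/double in v_lt.
rewrite !(bump_lt n.*2) ?(bump_lt n.*2.+1) // 1?ltnS 1?ltnW //.
rewrite /bump !leq0n /= negbK -/double !doubleS; case: ifP => _;
  case: leqP => ?; lia.
Qed.

(** Passing from n to n + 2 adds one transposition, and 'C(n + 2, 2) - 'C(n, 2) = 2n + 1 is odd. *)
Lemma sign_flip_odd n : flip_odd n = odd 'C(n, 2) :> bool.
Proof.
have [k] := ubnP n; elim: k n => // k IHk [|[|n]] nk.
- suff -> : flip_odd 0 = 1%g by rewrite odd_perm1.
  by apply/permP => -[].
- suff -> : flip_odd 1 = 1%g by rewrite odd_perm1.
  by apply/permP => -[[|[|//]] i]; apply: ord_inj; rewrite val_flip_odd perm1.
rewrite flip_oddSS !odd_lift_perm IHk; last lia.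
rewrite !binS !bin1 !bin0 !oddD /= -/double odd_double.
by case: (odd n); case: (odd _).
Qed.

(** * Vandermonde products *)

Section Vandermonde.
Variable K : comNzRingType.

Lemma prod_ord_lt n (F : nat -> nat -> K) :
  \prod_(j < n) \prod_(i < n | (i < j)%N) F j i =
  \prod_(0 <= j < n) \prod_(0 <= i < j) F j i.
Proof.
rewrite big_mkord; apply: eq_bigr => j _.
by rewrite (big_ord_narrow (ltnW (ltn_ord j))) big_mkord.
Qed.

Definition diff_prod (n : nat) (y : nat -> K) : K :=
  \prod_(0 <= j < n) \prod_(0 <= i < j) (y j - y i).

Lemma diff_prodS n y :
  diff_prod n.+1 y = diff_prod n y * \prod_(0 <= i < n) (y n - y i).
Proof. by rewrite /diff_prod big_nat_recr. Qed.

(** The matrix factors as a Vandermonde matrix times the coefficient matrix, which is triangular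
    with ones on the diagonal. *)
Lemma det_monic_poly n (p : nat -> {poly K}) (y : nat -> K) :
  (forall l, (l < n)%N -> p l \is monic /\ size (p l) = l.+1) ->
  \det (\matrix_(i < n, l < n) (p l).[y i]) = diff_prod n y.
Proof.
move=> p_monic; pose x : 'rV[K]_n := \row_i y i.
pose P : 'M[K]_n := \matrix_(i, j) (p j)`_i.
have -> : \matrix_(i < n, l < n) (p l).[y i] = (Vandermonde n x)^T *m P.
  apply/matrixP => i l; rewrite !mxE.
  rewrite (@horner_coef_wide _ n) => [|]; last by rewrite (p_monic l _).2.
  by apply: eq_bigr => j _; rewrite !mxE mulrC.
rewrite det_mulmx det_tr det_Vandermonde -[\det P]det_tr det_trig; last first.
  apply/is_trig_mxP => i j ij; rewrite !mxE nth_default //.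
  by rewrite (p_monic i _).2.
rewrite [X in _ * X]big1 ?mulr1 => [|i _]; last first.
  rewrite !mxE; have [/monicP + sz] := p_monic i (ltn_ord i).
  by rewrite lead_coefE sz.
rewrite (exchange_big_dep xpredT) //= /diff_prod -prod_ord_lt.
by apply: eq_bigr => j _; apply: eq_bigr => i _; rewrite !mxE.
Qed.

(** Replacing the p's by the q's permutes the columns by [flip_odd]. This is the origin of the sign
    (-1)^((N/2)(N/2-1)/2) in the theorem. *)
Lemma det_flip_odd_poly n (p q : nat -> {poly K}) (y : nat -> K) :
  (forall l, (l < n.*2)%N -> p l \is monic /\ size (p l) = l.+1) ->
  (forall l, q l = if odd l then p (n.*2 - l)%N else p l) ->
  \det (\matrix_(i < n.*2, l < n.*2) (q l).[y i]) =
  (-1) ^+ 'C(n, 2) * diff_prod n.*2 y.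
Proof.
move=> p_monic qE; rewrite -(det_monic_poly y p_monic).
rewrite -[(-1) ^+ _]signr_odd -sign_flip_odd -odd_permV -det_perm mulrC
  -det_mulmx -col_permE.
congr (\det _); apply/matrixP => i j; rewrite !mxE qE val_flip_odd.
by case: ifP.
Qed.

(* The sign counts the pairs a < b, each of which has one reversed factor
   w_b - w'_a = - (w'_a - w_b). *)
Lemma diff_prod_interleave k m (y w w' : nat -> K) :
  (forall s, (s < m)%N -> y (k + s.*2)%N = w s) ->
  (forall s, (s < m)%N -> y (k + s.*2).+1 = w' s) ->
  diff_prod (k + m.*2) y = (-1) ^+ 'C(m, 2) * (diff_prod k y
   * (\prod_(0 <= j < k) \prod_(0 <= s < m) ((w s - y j) * (w' s - y j)))
   * (\prod_(0 <= b < m) \prod_(0 <= a < b) ((w b - w a) * (w' b - w' a)))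
   * (\prod_(0 <= c < m) \prod_(0 <= d < m) (w' d - w c))).
Proof.
elim: m => [|m IHm] yw yw'.
  rewrite addn0 bin0n expr0 mul1r !big_nil !mulr1.
  by rewrite [X in _ * X]big1 ?mulr1 // => j _; rewrite big_nil.
have split_prod (f : K -> K) : \prod_(0 <= i < k + m.*2) f (y i) =
    (\prod_(0 <= j < k) f (y j)) * \prod_(0 <= s < m) (f (w s) * f (w' s)).
  clear IHm; elim: m yw yw' => [|m IHm] yw yw'.
    by rewrite addn0 [X in _ = _ * X]big_nil mulr1.
  rewrite doubleS !addnS !big_nat_recr //= IHm; last 2 first.
  - by move=> s sm; apply: yw; apply: ltnW.
  - by move=> s sm; apply: yw'; apply: ltnW.
  by rewrite yw // yw' // -!mulrA.
rewrite doubleS !addnS !diff_prodS big_nat_recr //= yw // yw' //.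
rewrite !(split_prod (fun z => _ - z)) IHm; last 2 first.
- by move=> s sm; apply: yw; apply: ltnW.
- by move=> s sm; apply: yw'; apply: ltnW.
rewrite binS bin1 exprD.
have -> : \prod_(0 <= s < m) ((w m - w s) * (w m - w' s)) =
   (-1) ^+ m * \prod_(0 <= s < m) ((w m - w s) * (w' s - w m)).
  have -> : (-1) ^+ m = \prod_(0 <= s < m) (-1) :> K.
    by rewrite prodr_const_nat subn0.
  by rewrite -big_split /=; apply: eq_bigr => s _; ring.
have -> : \prod_(0 <= j < k)
    \prod_(0 <= s < m.+1) ((w s - y j) * (w' s - y j)) =
  (\prod_(0 <= j < k) \prod_(0 <= s < m) ((w s - y j) * (w' s - y j))) *
  ((\prod_(0 <= j < k) (w m - y j)) * (\prod_(0 <= j < k) (w' m - y j))).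
  by rewrite -!big_split; apply: eq_bigr => j _; rewrite big_nat_recr.
have -> : \prod_(0 <= c < m.+1) \prod_(0 <= d < m.+1) (w' d - w c) =
  (\prod_(0 <= c < m) \prod_(0 <= d < m) (w' d - w c)) *
  (\prod_(0 <= s < m) (w' m - w s)) *
  (\prod_(0 <= s < m) (w' s - w m)) * (w' m - w m).
  rewrite big_nat_recr //= [X in _ * X]big_nat_recr //= !mulrA;
    congr (_ * _ * _).
  by rewrite -!big_split; apply: eq_bigr => j _; rewrite big_nat_recr.
rewrite [\prod_(0 <= b < m.+1) _]big_nat_recr //= !big_split /=.
ring.
Qed.
End Vandermonde.

Local Open Scope classical_set_scope.
Local Open Scope complex_scope.
Local Open Scope ring_scope.

(** * Complex-valued integrals and product measures *)

Section ReIm.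
Variable R : realType.
Implicit Types x y : R[i].
Lemma ReD x y : complex.Re (x + y) = complex.Re x + complex.Re y.
Proof. by case: x y => ? ? [? ?]. Qed.
Lemma ImD x y : complex.Im (x + y) = complex.Im x + complex.Im y.
Proof. by case: x y => ? ? [? ?]. Qed.
Lemma ReM x y : complex.Re (x * y) =
  complex.Re x * complex.Re y - complex.Im x * complex.Im y.
Proof. by case: x y => ? ? [? ?]. Qed.
Lemma ImM x y : complex.Im (x * y) =
  complex.Re x * complex.Im y + complex.Im x * complex.Re y.
Proof. by case: x y => ? ? [? ?]. Qed.
End ReIm.

Section Linear.
Context d (T : measurableType d) (R : realType).
Variable mu : {measure set T -> \bar R}.
Variables (D : set T) (mD : measurable D).
Implicit Types f g : T -> R[i].
Local Notation rint f := (mu.-integrable D (EFin \o f)).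

Lemma rintD (f g : T -> R) : rint f -> rint g -> rint (fun x => f x + g x).
Proof. by move=> f_int g_int; exact: (integrableD mD f_int g_int). Qed.

Lemma rintZ (c : R) (f : T -> R) : rint f -> rint (fun x => c * f x).
Proof. by move=> f_int; exact: (integrableZl mD c f_int). Qed.

Lemma cintegrableD f g : cintegrable mu D f -> cintegrable mu D g ->
  cintegrable mu D (fun x => f x + g x).
Proof.
move=> [fr fi] [gr gi]; split.
  by under [X in _ \o X]eq_fun do rewrite ReD; exact: rintD.
by under [X in _ \o X]eq_fun do rewrite ImD; exact: rintD.
Qed.

Lemma cintegralD f g : cintegrable mu D f -> cintegrable mu D g ->
  cintegral mu D (fun x => f x + g x) = cintegral mu D f + cintegral mu D g.
Proof.
move=> [fr fi] [gr gi]; rewrite /cintegral; simpc; congr (_ +i* _).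
  by rewrite -RintegralD//; apply: eq_Rintegral => x _; rewrite ReD.
by rewrite -RintegralD//; apply: eq_Rintegral => x _; rewrite ImD.
Qed.

Lemma cintegrableZ (c : R[i]) f : cintegrable mu D f ->
  cintegrable mu D (fun x => c * f x).
Proof.
move=> [fr fi]; split.
  under [X in _ \o X]eq_fun do rewrite ReM -mulNr.
  by apply: rintD; exact: rintZ.
under [X in _ \o X]eq_fun do rewrite ImM.
by apply: rintD; exact: rintZ.
Qed.

Lemma cintegralZ (c : R[i]) f : cintegrable mu D f ->
  cintegral mu D (fun x => c * f x) = c * cintegral mu D f.
Proof.
move=> [fr fi]; case: c => a b; rewrite /cintegral; simpc; congr (_ +i* _).
  rewrite -!RintegralZl// -RintegralB//; [|exact: rintZ|exact: rintZ].
  by apply: eq_Rintegral => x _; rewrite ReM.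
rewrite -!RintegralZl// -RintegralD//; [|exact: rintZ|exact: rintZ].
by apply: eq_Rintegral => x _; rewrite ImM.
Qed.

Lemma eq_cintegral f g : (forall x, D x -> f x = g x) ->
  cintegral mu D f = cintegral mu D g.
Proof.
by move=> fg; congr (_ +i* _); apply: eq_Rintegral => x /set_mem/fg ->.
Qed.

Lemma cintegral0 : cintegral mu D (fun=> 0) = 0.
Proof. by rewrite /cintegral /Rintegral /= integral0. Qed.

Lemma cintegrable0 : cintegrable mu D (fun=> 0).
Proof. by split; exact: integrable0. Qed.

Lemma cintegrable_sum I (s : seq I) (F : I -> T -> R[i]) :
  (forall i, cintegrable mu D (F i)) ->
  cintegrable mu D (fun x => \sum_(i <- s) F i x).
Proof.
move=> Fint; elim: s => [|i s IHs].
  by under eq_fun do rewrite big_nil; exact: cintegrable0.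
by under eq_fun do rewrite big_cons; exact: cintegrableD.
Qed.

Lemma cintegral_sum I (s : seq I) (F : I -> T -> R[i]) :
  (forall i, cintegrable mu D (F i)) ->
  cintegral mu D (fun x => \sum_(i <- s) F i x) =
  \sum_(i <- s) cintegral mu D (F i).
Proof.
move=> Fint; elim: s => [|i s IHs].
  by under eq_fun do rewrite big_nil; rewrite big_nil cintegral0.
under eq_fun do rewrite big_cons.
by rewrite cintegralD ?IHs ?big_cons//; exact: cintegrable_sum.
Qed.

(** Signs and indicators enter as bounded real weights; by this lemma they never cost
    integrability. *)
Lemma cintegrable_bounded (h : T -> R) f :
  measurable_fun D h -> (forall x, `|h x| <= 1) -> cintegrable mu D f ->
  cintegrable mu D (fun x => (h x)%:C * f x).
Proof.
move=> mh h1 [fr fi].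
have bh : [bounded h x | x in D].
  exists 1; split; first exact: num_real.
  by move=> M M1 x _; apply: le_trans (h1 x) (ltW M1).
split.
  under [X in _ \o X]eq_fun do rewrite ReM /= mul0r subr0.
  exact: (integrableMr mD mh bh fr).
under [X in _ \o X]eq_fun do rewrite ImM /= mul0r addr0.
exact: (integrableMr mD mh bh fi).
Qed.
End Linear.
Arguments eq_cintegral {d T R mu D f} g.

Section Restrict.
Context d (T : measurableType d) (R : realType).
Variable mu : {measure set T -> \bar R}.
Implicit Types (D : set T) (f : T -> R[i]).

(** Domains become indicator weights, so that Fubini and permutations of coordinates are needed only
    on the whole space. *)
Lemma cintegral_mkcond D f :
  cintegral mu D f = cintegral mu setT (fun x => (\1_D x)%:C * f x).
Proof.
rewrite /cintegral Rintegral_mkcond [X in _ +i* X]Rintegral_mkcond.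
congr (_ +i* _); apply: eq_Rintegral => x _; rewrite patchE indicE.
  by case: (x \in D); rewrite ?mul1r ?mul0r.
by case: (x \in D); rewrite ?mul1r ?mul0r.
Qed.

Lemma cintegrable_mkcond D f : measurable D -> cintegrable mu D f ->
  cintegrable mu setT (fun x => (\1_D x)%:C * f x).
Proof.
move=> mD [/(integrable_mkcond _ mD).1 fr /(integrable_mkcond _ mD).1 fi].
split; [move: fr|move: fi]; apply: eq_integrable => //= x _;
  rewrite patchE indicE /=; by case: (x \in D); rewrite ?mul1r ?mul0r.
Qed.
End Restrict.

Section Product.
Context d1 d2 (T1 : measurableType d1) (T2 : measurableType d2) (R : realType).
Variable mu : {sigma_finite_measure set T1 -> \bar R}.
Variable nu : {sigma_finite_measure set T2 -> \bar R}.

(** By Tonelli the iterated integral of the absolute value is a product of two finite integrals. *)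
Lemma integrable_tensor (f : T1 -> R) (g : T2 -> R) :
  mu.-integrable setT (EFin \o f) -> nu.-integrable setT (EFin \o g) ->
  (prod_measure mu nu).-integrable setT (EFin \o (fun z => f z.1 * g z.2)).
Proof.
move=> f_int g_int.
have mf := measurable_int _ f_int; have mg := measurable_int _ g_int.
have mF : measurable_fun [set: T1 * T2] (fun z => f z.1 * g z.2).
  apply: measurable_funM.
    by apply: measurableT_comp; [exact/measurable_EFinP|exact: measurable_fst].
  by apply: measurableT_comp; [exact/measurable_EFinP|exact: measurable_snd].
apply/(integrable12ltyP _ _ ((measurable_EFinP _ _).2 mF)).
have /integrableP[_ fo] := f_int; have /integrableP[_ go] := g_int.
under eq_integral => x _.
  under eq_integral do rewrite /= normrM EFinM.
  rewrite ge0_integralZl//; last first.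
    by apply/measurable_EFinP; apply: measurableT_comp => //;
      exact/measurable_EFinP.
  over.
rewrite ge0_integralZr//; last 2 first.
- by apply/measurable_EFinP; apply: measurableT_comp => //;
  exact/measurable_EFinP.
- exact: integral_ge0.
by rewrite lte_mul_pinfty ?integral_ge0 // ge0_fin_numE ?integral_ge0.
Qed.

Lemma cintegrable_tensor (f : T1 -> R[i]) (g : T2 -> R[i]) :
  cintegrable mu setT f -> cintegrable nu setT g ->
  cintegrable (prod_measure mu nu) setT (fun z => f z.1 * g z.2).
Proof.
move=> [fr fi] [gr gi]; split.
  under [X in _ \o X]eq_fun do rewrite ReM.
  under [X in _ \o X]eq_fun do rewrite -mulNr.
  have fi' : mu.-integrable setT (EFin \o (fun x => - complex.Im (f x))).
    have := rintZ measurableT (-1) fi.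
    by under [X in _ \o X]eq_fun do rewrite mulN1r.
  exact: (rintD measurableT (integrable_tensor fr gr) (integrable_tensor fi'
    gi)).
under [X in _ \o X]eq_fun do rewrite ImM.
exact: (rintD measurableT (integrable_tensor fr gi) (integrable_tensor fi gr)).
Qed.

Lemma Rintegral_fubini (h : T1 * T2 -> R) :
  (prod_measure mu nu).-integrable setT (EFin \o h) ->
  (forall x, nu.-integrable setT (EFin \o (fun y => h (x, y)))) ->
  (\int[prod_measure mu nu]_z h z = \int[mu]_x \int[nu]_y h (x, y))%R.
Proof.
move=> h_int hx_int; rewrite /Rintegral; congr fine.
rewrite -(integral12_prod_meas1 h_int); apply: eq_integral => x _.
by rewrite fineK //; exact: (integrable_fin_num measurableT (hx_int x)).
Qed.

Lemma cintegrable_fubini (h : T1 * T2 -> R[i]) :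
  cintegrable (prod_measure mu nu) setT h ->
  (forall x, cintegrable nu setT (fun y => h (x, y))) ->
  cintegrable mu setT (fun x => cintegral nu setT (fun y => h (x, y))).
Proof.
move=> [hr hi] hx; split.
  have := integrable_fubini_F hr; apply: eq_integrable => //= x _.
  by rewrite fineK //; exact: (integrable_fin_num measurableT (hx x).1).
have := integrable_fubini_F hi; apply: eq_integrable => //= x _.
by rewrite fineK //; exact: (integrable_fin_num measurableT (hx x).2).
Qed.

Lemma cintegral_fubini (h : T1 * T2 -> R[i]) :
  cintegrable (prod_measure mu nu) setT h ->
  (forall x, cintegrable nu setT (fun y => h (x, y))) ->
  cintegral (prod_measure mu nu) setT h =
  cintegral mu setT (fun x => cintegral nu setT (fun y => h (x, y))).
Proof.
move=> [hr hi] hx; congr (_ +i* _); apply: Rintegral_fubini => // x.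
  exact: (hx x).1.
exact: (hx x).2.
Qed.
End Product.

Section Cons.
Context d (T : measurableType d) (R : realType).
Variable mu : {sigma_finite_measure set T -> \bar R}.

Definition tuncons n (t : n.+1.-tuple T) : T * n.-tuple T :=
  (thead t, [tuple of behead t]).

Lemma tunconsK n : cancel (@tuncons n) (@tcons _ T n).
Proof. by move=> t; apply: val_inj; rewrite /= {3}(tuple_eta t). Qed.

Lemma measurable_tuncons n : measurable_fun setT (@tuncons n).
Proof.
apply/measurable_fun_pairP; split; first exact: measurable_tnth.
exact: measurable_behead.
Qed.

Section nu.
Variables (n : nat) (nu : {sigma_finite_measure set (n.-tuple T) -> \bar R}).

Lemma measurable_cons_fun (f : n.+1.-tuple T -> R) :
  measurable_fun setT (f \o @tcons _ T n) -> measurable_fun setT f.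
Proof.
move=> mf; rewrite (_ : f = (f \o @tcons _ T n) \o @tuncons n).
  exact: measurableT_comp mf (@measurable_tuncons n).
by apply/funext => t /=; rewrite tunconsK.
Qed.

Lemma integrable_cons (f : n.+1.-tuple T -> R) :
  (prod_measure mu nu).-integrable setT (EFin \o (f \o @tcons _ T n)) ->
  (cons_measure mu nu).-integrable setT (EFin \o f).
Proof.
move=> f_int; apply: (@integrable_pushforward _ _ _ _ R (@tcons _ T n)
  (@measurable_tcons _ T n) (prod_measure mu nu) setT (EFin \o f)) => //.
apply/measurable_EFinP; apply: measurable_cons_fun.
exact: ((measurable_EFinP _ _).1 (measurable_int _ f_int)).
Qed.

Lemma Rintegral_cons (f : n.+1.-tuple T -> R) :
  (prod_measure mu nu).-integrable setT (EFin \o (f \o @tcons _ T n)) ->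
  (\int[cons_measure mu nu]_t f t =
   \int[prod_measure mu nu]_z (f \o @tcons _ T n) z)%R.
Proof.
move=> f_int; rewrite /Rintegral; congr fine.
apply: (@integral_pushforward _ _ _ _ R (@tcons _ T n) (@measurable_tcons _ T n)
  (prod_measure mu nu) setT (EFin \o f)) => //.
apply/measurable_EFinP; apply: measurable_cons_fun.
exact: ((measurable_EFinP _ _).1 (measurable_int _ f_int)).
Qed.

Lemma cintegrable_cons (F : n.+1.-tuple T -> R[i]) :
  cintegrable (prod_measure mu nu) setT (F \o @tcons _ T n) ->
  cintegrable (cons_measure mu nu) setT F.
Proof. by move=> [Fr Fi]; split; exact: integrable_cons. Qed.

Lemma cintegral_cons (F : n.+1.-tuple T -> R[i]) :
  cintegrable (prod_measure mu nu) setT (F \o @tcons _ T n) ->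
  cintegral (cons_measure mu nu) setT F =
  cintegral (prod_measure mu nu) setT (F \o @tcons _ T n).
Proof. by move=> [Fr Fi]; congr (_ +i* _); exact: Rintegral_cons. Qed.

Variables (f : T -> R[i]) (g : n.-tuple T -> R[i]) (h : n.+1.-tuple T -> R).
Hypothesis f_int : cintegrable mu setT f.
Hypothesis g_int : cintegrable nu setT g.
Hypothesis mh : measurable_fun setT h.
Hypothesis h1 : forall t, `|h t| <= 1.

Let F t := (h t)%:C * (f (thead t) * g [tuple of behead t]).

Let FE : F \o @tcons _ T n = fun z => (h (tcons z))%:C * (f z.1 * g z.2).
Proof.
apply/funext => -[a s]; rewrite /F /= theadE; congr (_ * (_ * g _)).
by apply: val_inj.
Qed.

Let F_int : cintegrable (prod_measure mu nu) setT (F \o @tcons _ T n).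
Proof.
rewrite FE; apply: (cintegrable_bounded measurableT (h := h \o @tcons _ T n))
  => //.
  exact: measurableT_comp mh (@measurable_tcons _ T n).
  by move=> z; exact: h1.
exact: cintegrable_tensor.
Qed.

Lemma cintegrable_weighted_cons : cintegrable (cons_measure mu nu) setT F.
Proof. exact: cintegrable_cons. Qed.

Lemma measurable_tcons1 x :
  measurable_fun setT (fun s : n.-tuple T => tcons (x, s)).
Proof. by apply: measurable_cons => //; exact: measurable_id. Qed.

(** The weight [h] may couple head and tail, so the integral need not factor; its boundedness makes
    every section integrable, as [cintegral_fubini] asks. *)
Lemma cintegral_weighted_cons : cintegral (cons_measure mu nu) setT F =
  cintegral mu setT (fun x => f x *
    cintegral nu setT (fun s => (h (tcons (x, s)))%:C * g s)).
Proof.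
have hg_int x : cintegrable nu setT (fun s => (h (tcons (x, s)))%:C * g s).
  apply: (cintegrable_bounded measurableT (h := h \o (fun s => tcons (x,
    s)))) => //.
    exact: measurableT_comp mh (measurable_tcons1 x).
  by move=> s; exact: h1.
have E x : (fun s => (h (tcons (x, s)))%:C * (f x * g s)) =
    (fun s => f x * ((h (tcons (x, s)))%:C * g s)).
  by apply/funext => s; rewrite mulrCA.
rewrite cintegral_cons //; move: F_int; rewrite FE => F_int'.
rewrite (cintegral_fubini F_int') /=.
  by apply: eq_cintegral => x _; rewrite E (cintegralZ measurableT).
by move=> x /=; rewrite E; exact: cintegrableZ.
Qed.
End nu.

Lemma tcons_tnth n (t : n.+1.-tuple T) (i : 'I_n) :
  tnth [tuple of behead t] i = tnth t (lift ord0 i).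
Proof.
by rewrite tnth_behead; congr tnth; apply: ord_inj; rewrite lift0 inordK ?ltnS.
Qed.

Lemma cintegral_power_prod n (f : 'I_n -> T -> R[i]) :
  (forall i, cintegrable mu setT (f i)) ->
  cintegrable (power_measure mu n) setT
    (fun t => \prod_(i < n) f i (tnth t i)) /\
  cintegral (power_measure mu n) setT
    (fun t => \prod_(i < n) f i (tnth t i)) =
  \prod_(i < n) cintegral mu setT (f i).
Proof.
elim: n f => [|n IHn] f f_int /=.
  under [X in cintegrable _ _ X]eq_fun do rewrite big_ord0.
  under [X in cintegral _ _ X]eq_fun do rewrite big_ord0.
  rewrite big_ord0; split; first split.
  - exact: finite_measure_integrable_cst.
  - exact: finite_measure_integrable_cst.
  - have D1 : power_measure mu 0 setT = 1%E by exact: diracT.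
    rewrite /cintegral !Rintegral_cst // (_ : fine _ = 1) ?mulr1 ?mul0r //.
    by rewrite -[RHS]/(fine 1%E) -D1.
have [g_int IH] := IHn (fun i => f (lift ord0 i)) (fun i => f_int _).
set g : n.-tuple T -> R[i] := fun s => _ in g_int IH.
have E : (fun t : n.+1.-tuple T => \prod_(i < n.+1) f i (tnth t i)) =
    fun t => (1 : R)%:C * (f ord0 (thead t) * g [tuple of behead t]).
  apply/funext => t; rewrite mul1r big_ord_recl; congr (_ * _).
  by apply: eq_bigr => i _; rewrite tcons_tnth.
have n1 : forall t : n.+1.-tuple T, `|(1 : R)| <= 1 by rewrite normr1.
have m1 : measurable_fun [set: n.+1.-tuple T] (fun=> 1 : R) by exact:
  measurable_cst.
rewrite E; split; first exact: (cintegrable_weighted_cons (f_int ord0) g_int m1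
  n1).
rewrite (cintegral_weighted_cons (f_int ord0) g_int m1 n1) big_ord_recl -IH.
rewrite [RHS]mulrC -(cintegralZ measurableT) //; apply: eq_cintegral => x _.
by rewrite mulrC; congr (_ * _); apply: eq_cintegral => s _; rewrite mul1r.
Qed.
End Cons.

Section Pairs.
Variable R : realType.
Local Notation leb := (@lebesgue_measure R).
Local Notation Rm := (measurableTypeR R).

Definition pair_sgn r (t : r.*2.-tuple Rm) : R :=
  \prod_(i < r) Num.sg (tnth t (ord_odd i) - tnth t (ord_even i)).

Lemma normr_sg_le1 (x : R) : `|Num.sg x| <= 1.
Proof. by rewrite normr_sg lern1 leq_b1. Qed.

Lemma normr_pair_sgn r (t : r.*2.-tuple Rm) : `|pair_sgn t| <= 1.
Proof.
rewrite normr_prod; apply: prodr_ile1 => i _.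
by rewrite normr_ge0 normr_sg_le1.
Qed.

Lemma measurable_sgB d (T : measurableType d) (f g : T -> R) :
  measurable_fun setT f -> measurable_fun setT g ->
  measurable_fun setT (fun x => Num.sg (f x - g x)).
Proof.
move=> mf mg.
rewrite (_ : (fun _ => _) =
  (fun x => if g x < f x then 1 else if f x < g x then -1 else 0 : R)).
  apply: measurable_fun_ifT; [exact: measurable_fun_ltr|exact: measurable_cst|].
  apply: measurable_fun_ifT; [exact: measurable_fun_ltr|exact: measurable_cst|].
  exact: measurable_cst.
apply/funext => x; case: ltgtP => [fg|fg|->].
- by rewrite gtr0_sg // subr_gt0.
- by rewrite ltr0_sg // subr_lt0.
- by rewrite subrr sgr0.
Qed.

Lemma measurable_pair_sgn r : measurable_fun setT (@pair_sgn r).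
Proof.
apply: measurable_prod => i _; apply: measurable_sgB; exact: measurable_tnth.
Qed.

(** An entry of alpha without its factor -i/2; the interval of integration is carried by [a] and
    [b]. *)
Definition sgn_int (a b : Rm -> R[i]) : R[i] :=
  cintegral leb setT (fun x => a x *
    cintegral leb setT (fun y => (Num.sg (y - x))%:C * b y)).

Lemma measurable_sgB1 x :
  measurable_fun setT (fun y : Rm => Num.sg (y - x : R)).
Proof.
by apply: measurable_sgB; [exact: measurable_id|exact: measurable_cst].
Qed.

(** The outer integrand is a section integral of one integrable function of two variables, so Fubini
    supplies its integrability. *)
Lemma sgn_int_inner a b : cintegrable leb setT a -> cintegrable leb setT b ->
  cintegrable leb setT (fun x => a x *
    cintegral leb setT (fun y => (Num.sg (y - x))%:C * b y)).
Proof.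
move=> a_int b_int.
have sb_int x : cintegrable leb setT (fun y : Rm => (Num.sg (y - x))%:C * b y).
  apply: (cintegrable_bounded measurableT (measurable_sgB1 x)) => //.
  by move=> y; exact: normr_sg_le1.
pose h (z : Rm * Rm) : R[i] := (Num.sg (z.2 - z.1))%:C * (a z.1 * b z.2).
have E x y : h (x, y) = a x * ((Num.sg (y - x))%:C * b y) by rewrite /h mulrCA.
have h_int : cintegrable (prod_measure leb leb) setT h.
  apply: (cintegrable_bounded measurableT (h := fun z : Rm * Rm => Num.sg (z.2
    - z.1))).
  - by apply: measurable_sgB; [exact: measurable_snd|exact: measurable_fst].
  - by move=> z; exact: normr_sg_le1.
  - exact: cintegrable_tensor.
have hx x : cintegrable leb setT (fun y => h (x, y)).
  by under eq_fun do rewrite E; exact: cintegrableZ.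
have := cintegrable_fubini h_int hx; congr cintegrable; apply/funext => x.
under [in LHS]eq_cintegral do rewrite E.
exact: cintegralZ.
Qed.

(** Two coordinates are peeled off at each step: [pair_sgn] is the sign for these two times the same
    product for the rest, so the integral over the rest is a constant [P] that leaves the two outer
    integrals. *)
Lemma cintegral_pairs r (a : 'I_r.*2 -> Rm -> R[i]) :
  (forall j, cintegrable leb setT (a j)) ->
  cintegral (power_measure leb r.*2) setT
    (fun t => (pair_sgn t)%:C * \prod_(j < r.*2) a j (tnth t j)) =
  \prod_(i < r) sgn_int (a (ord_even i)) (a (ord_odd i)).
Proof.
elim: r a => [|r IHr] a a_int.
  rewrite big_ord0; transitivity (\prod_(j < 0.*2) cintegral leb setT (a j));
    last first.
    by rewrite big_ord0.
  rewrite -(cintegral_power_prod a_int).2.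
  by apply: eq_cintegral => t _; rewrite /pair_sgn big_ord0 mul1r.
pose a2 (j : 'I_r.*2) := a (lift ord0 (lift ord0 j) : 'I_r.*2.+2).
pose o1 : 'I_r.*2.+2 := lift ord0 ord0.
pose g1 (s : r.*2.+1.-tuple Rm) := \prod_(j < r.*2.+1) a (lift ord0 j :
  'I_r.*2.+2) (tnth s j).
pose g2 (s : r.*2.-tuple Rm) := \prod_(j < r.*2) a2 j (tnth s j).
have a2_int j : cintegrable leb setT (a2 j) by exact: a_int.
have g1_int : cintegrable (power_measure leb r.*2.+1) setT g1.
  exact: (cintegral_power_prod (f := fun j => a (lift ord0 j : 'I_r.*2.+2))
    (fun j => a_int _)).1.
have g2_int : cintegrable (power_measure leb r.*2) setT g2.
  exact: (cintegral_power_prod a2_int).1.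
have sgn_cons x y s : pair_sgn (tcons (x, tcons (y, s)) : r.+1.*2.-tuple Rm) =
    Num.sg (y - x) * pair_sgn s.
  rewrite /pair_sgn big_ord_recl; congr (Num.sg (_ - _) * _).
  by apply: eq_bigr => i _; congr (Num.sg (_ - _)); rewrite !(tnth_nth 0).
have sg2_int : cintegrable (power_measure leb r.*2) setT (fun s => (pair_sgn
  s)%:C * g2 s).
  apply: (cintegrable_bounded measurableT (@measurable_pair_sgn r)) => //.
  exact: normr_pair_sgn.
transitivity (cintegral (cons_measure leb (power_measure leb r.*2.+1)) setT
   (fun t => (@pair_sgn r.+1 t)%:C * (a ord0 (thead t) * g1 [tuple of behead
     t]))).
  apply: eq_cintegral => t _; congr (_ * _).
  rewrite [LHS]big_ord_recl; congr (_ * _).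
  by apply: eq_bigr => j _; rewrite tcons_tnth.
rewrite (cintegral_weighted_cons (a_int ord0) g1_int (@measurable_pair_sgn
  r.+1) (@normr_pair_sgn r.+1)).
pose P := \prod_(i < r) sgn_int (a2 (ord_even i)) (a2 (ord_odd i)).
have inner x : cintegral (power_measure leb r.*2.+1) setT
    (fun s => (@pair_sgn r.+1 (tcons (x, s)))%:C * g1 s) =
    P *
    cintegral leb setT (fun y => (Num.sg (y - x))%:C * a o1 y).
  transitivity (cintegral (cons_measure leb (power_measure leb r.*2)) setT
    (fun s => (@pair_sgn r.+1 (tcons (x,
      s)))%:C * (a o1 (thead s) * g2 [tuple of behead s]))).
    apply: eq_cintegral => s _; congr (_ * _).
    rewrite /g1 [LHS]big_ord_recl; congr (_ * _).
    by apply: eq_bigr => j _; rewrite tcons_tnth.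
  rewrite (cintegral_weighted_cons (h := fun s => @pair_sgn r.+1 (tcons (x,
    s))) (a_int o1) g2_int); last 2 first.
  - exact: measurableT_comp (@measurable_pair_sgn r.+1) (measurable_tcons1 x).
  - by move=> s; exact: normr_pair_sgn.
  rewrite -(cintegralZ measurableT); last first.
    apply: (cintegrable_bounded measurableT (measurable_sgB1 x)) => //.
    by move=> y; exact: normr_sg_le1.
  apply: eq_cintegral => y _.
  rewrite [RHS]mulrC [RHS]mulrAC [RHS]mulrC; congr (_ * _).
  rewrite /P -IHr // -(cintegralZ measurableT) //; apply: eq_cintegral => s _.
  by rewrite sgn_cons rmorphM mulrA.
rewrite big_ord_recl mulrC.
transitivity (P * sgn_int (a ord0) (a o1)).
  rewrite -(cintegralZ measurableT); last exact: sgn_int_inner.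
  by apply: eq_cintegral => x _; rewrite inner mulrCA.
have e0 : ord_even (ord0 : 'I_r.+1) = ord0 :> 'I_r.*2.+2 by apply: val_inj.
have e1 : ord_odd (ord0 : 'I_r.+1) = o1 by apply: val_inj.
have eP : P =
    \prod_(i < r) sgn_int (a (ord_even (lift ord0 i))) (a (ord_odd (lift ord0
      i))).
  apply: eq_bigr => i _.
  have -> : ord_even (lift ord0 i) =
    lift ord0 (lift ord0 (ord_even i)) :> 'I_r.*2.+2.
    by apply: val_inj.
  have -> : ord_odd (lift ord0 i) =
    lift ord0 (lift ord0 (ord_odd i)) :> 'I_r.*2.+2.
    by apply: val_inj.
  by [].
by rewrite eP -e0 -e1.
Qed.
End Pairs.

(** * Permutation invariance and the ordered chamber *)

Definition perm_tuple T n (s : 'S_n) (t : n.-tuple T) : n.-tuple T :=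
  [tuple tnth t (s i) | i < n].

Lemma tnth_perm_tuple T n (s : 'S_n) (t : n.-tuple T) i :
  tnth (perm_tuple s t) i = tnth t (s i).
Proof. exact: tnth_mktuple. Qed.

Lemma perm_tupleM T n (s s' : 'S_n) (t : n.-tuple T) :
  perm_tuple (s * s')%g t = perm_tuple s (perm_tuple s' t).
Proof. by apply: eq_from_tnth => i; rewrite !tnth_perm_tuple permM. Qed.

Lemma perm_tuple1 T n (t : n.-tuple T) : perm_tuple 1%g t = t.
Proof. by apply: eq_from_tnth => i; rewrite !tnth_perm_tuple perm1. Qed.

Section Invariance.
Context d (T : measurableType d) (R : realType).
Variable mu : {sigma_finite_measure set T -> \bar R}.

Definition box n (A : 'I_n -> set T) : set (n.-tuple T) :=
  [set t | forall i, A i (tnth t i)].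

Lemma measurable_box n (A : 'I_n -> set T) :
  (forall i, measurable (A i)) -> measurable (box A).
Proof.
move=> mA; rewrite (_ : box A =
    \bigcap_(i in [set: 'I_n]) ((fun t : n.-tuple T => tnth t i) @^-1` A i)).
  apply: fin_bigcap_measurable => [|i _]; first exact: finite_finset.
  by rewrite -[X in measurable X]setTI; exact: measurable_tnth.
by apply/seteqP; split => t /= At i *; exact: At.
Qed.

Lemma power_measure_box n (A : 'I_n -> set T) : (forall i, measurable (A i)) ->
  power_measure mu n (box A) = (\big[*%E/1%E]_(i < n) mu (A i))%E.
Proof.
elim: n A => [|n IHn] A mA.
  rewrite big_ord0 (_ : box A = setT); first exact: diracT.
  by apply/seteqP; split => t //= _ [].
rewrite big_ord_recl -IHn => [|i]; last exact: mA.
rewrite -product_measure1E //; last by apply: measurable_box => i; exact: mA.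
rewrite /= /cons_measure /pushforward; congr (_ _).
apply/seteqP; split => -[x t] /= At.
  split; first by have := At ord0; rewrite (tnth_nth x).
  move=> i; have := At (lift ord0 i); rewrite /= !(tnth_nth x).
  by rewrite lift0.
move=> i; case: (unliftP ord0 i) => [j|] ->; rewrite (tnth_nth x) //=.
  by have := At.2 j; rewrite (tnth_nth x).
exact: At.1.
Qed.

Lemma measurable_perm_tuple n (s : 'S_n) :
  measurable_fun setT (@perm_tuple T n s).
Proof.
apply/measurable_fun_tnthP => i; rewrite (_ : _ \o _ = fun t => tnth t (s i)).
  exact: measurable_tnth.
by apply/funext => t /=; rewrite tnth_perm_tuple.
Qed.

Definition boxes n : set (set (n.-tuple T)) :=
  [set B | exists2 A : 'I_n -> set T, forall i, measurable (A i) & B = box A].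

(** The sigma-algebra on tuples is generated by preimages under single coordinates, which are boxes
    with one nontrivial side. Boxes are moreover closed under intersection, which uniqueness of
    measures requires. *)
Lemma measurable_boxes n : @measurable _ (n.-tuple T) = <<s @boxes n >>.
Proof.
apply/seteqP; split.
  apply: smallest_sub; first exact: smallest_sigma_algebra.
  apply: (big_ind (fun S => S `<=` <<s @boxes n >>)).
  - by [].
  - by move=> S S' SG S'G B [/SG|/S'G].
  move=> i _ B [C mC <-]; apply: sub_sigma_algebra.
  exists (fun j => if j == i then C else setT).
    by move=> j; case: ifP.
  rewrite setTI; apply/seteqP; split => t /=.
    by move=> Ct j; case: eqP => [->|].
  by move=> /(_ i); rewrite eqxx.
apply: smallest_sub; first exact: sigma_algebra_measurable.
by move=> B [A mA ->]; exact: measurable_box.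
Qed.

(** On boxes a permutation only reorders the factors of a product. Boxes generate, are closed under
    intersection, and cover the space by sets of finite measure, so the two measures coincide. *)
Lemma power_measure_perm n (s : 'S_n) (B : set (n.-tuple T)) : measurable B ->
  power_measure mu n (perm_tuple s @^-1` B) = power_measure mu n B.
Proof.
move=> mB; apply/esym.
have /sigma_finiteP[F [TF ndF Foo]] := sigma_finiteT mu.
pose m2 : {measure set (n.-tuple T) -> \bar R} :=
  measure_function_pushforward__canonical__measure_function_Measure
    (power_measure mu n) (measurable_perm_tuple s).
change (power_measure mu n B = m2 B).
apply: (measure_unique (@boxes n) (fun k => box (fun=> F k))) => //.
- exact: measurable_boxes.
- move=> _ _ [A mA ->] [A' mA' ->]; exists (fun i => A i `&` A' i).
    by move=> i; exact: measurableI.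
  apply/seteqP; split => t /=; first by move=> [At A't] i; split.
  by move=> AAt; split=> i; have [] := AAt i.
- by move=> k; exists (fun=> F k) => // i; have [] := Foo k.
- apply/seteqP; split => // t _.
  have /choice[f tf] : forall i : 'I_n, exists k, F k (tnth t i).
    move=> i; have : setT (tnth t i) by [].
    by rewrite TF => -[k _ Fk]; exists k.
  (* [F] is nondecreasing, so the largest index serves all coordinates at once. *)
  exists (\max_(i < n) f i)%N => // i.
  by apply: (subsetPset _ _ (ndF _ _ (leq_bigmax i))); exact: tf.
- move=> _ [A mA ->]; transitivity (\big[*%E/1%E]_(i < n) mu (A i))%E.
    exact: power_measure_box.
  transitivity (power_measure mu n (box (fun i => A (s^-1%g i)))).
    rewrite power_measure_box // [LHS](reindex_inj (@perm_inj _ s^-1%g)) //.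
  congr (_ _); apply/seteqP; split => t /= At i.
    by rewrite tnth_perm_tuple; have := At (s i); rewrite permK.
  by have := At (s^-1%g i); rewrite tnth_perm_tuple permKV.
- move=> k; have [_ Fk] := Foo k.
  have : power_measure mu n (box (fun=> F k)) \is a fin_num.
    rewrite power_measure_box; last by move=> i; have [] := Foo k.
    apply: (big_ind (fun x => x \is a fin_num)) => //; first exact: fin_numM.
    by move=> _ _; rewrite ge0_fin_numE.
  by rewrite ge0_fin_numE.
Qed.

Lemma Rintegral_perm n (s : 'S_n) (f : n.-tuple T -> R) :
  (power_measure mu n).-integrable setT (EFin \o (f \o perm_tuple s)) ->
  measurable_fun setT f ->
  (\int[power_measure mu n]_t f (perm_tuple s t) =
   \int[power_measure mu n]_t f t)%R.
Proof.
move=> f_int mf; rewrite /Rintegral; congr fine.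
rewrite -[LHS](@integral_pushforward _ _ _ _ R _ (measurable_perm_tuple s)
  (power_measure mu n) setT (EFin \o f)) //; last exact/measurable_EFinP.
apply: (@eq_measure_integral _ _ _ _ _
  (measure_function_pushforward__canonical__measure_function_Measure
    (power_measure mu n) (measurable_perm_tuple s))) => B mB _.
exact: power_measure_perm.
Qed.

Lemma cintegral_perm n (s : 'S_n) (f : n.-tuple T -> R[i]) :
  cintegrable (power_measure mu n) setT (f \o perm_tuple s) ->
  cintegral (power_measure mu n) setT (f \o perm_tuple s) =
  cintegral (power_measure mu n) setT f.
Proof.
(* Composing with the inverse permutation recovers [g] from its permuted version. *)
have mf (g : n.-tuple T -> R) : measurable_fun setT (g \o perm_tuple s) ->
    measurable_fun setT g.
  move=> mg; rewrite (_ : g = (g \o perm_tuple s) \o perm_tuple s^-1%g).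
    exact: measurableT_comp mg (measurable_perm_tuple _).
  by apply/funext => t /=; rewrite -perm_tupleM mulgV perm_tuple1.
move=> [fr fi]; congr (_ +i* _); apply: Rintegral_perm => //; apply: mf.
  exact: ((measurable_EFinP _ _).1 (measurable_int _ fr)).
exact: ((measurable_EFinP _ _).1 (measurable_int _ fi)).
Qed.
End Invariance.

Section Chamber.
Variable R : realType.
Local Notation leb := (@lebesgue_measure R).
Local Notation Rm := (measurableTypeR R).

(** The bounds 0 and 2 pi of the ordered angles are left to the integrand: without them the images
    of the chamber under permutations cover all tuples with distinct coordinates. *)
Definition chamber n : set (n.-tuple Rm) :=
  [set t | forall i j : 'I_n, (i < j)%N -> (tnth t i : R) < tnth t j].

Lemma measurable_chamber n : measurable (@chamber n).
Proof.
pose lt_set (p : 'I_n * 'I_n) : set (n.-tuple Rm) :=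
  [set t | (tnth t p.1 : R) < tnth t p.2].
rewrite (_ : @chamber n =
    \bigcap_(p in [set p : 'I_n * 'I_n | (p.1 < p.2)%N]) lt_set p).
  apply: fin_bigcap_measurable => [|p _]; first exact: finite_finset.
  rewrite -[X in measurable X]setTI.
  have mlt : measurable_fun setT
      (fun t : n.-tuple Rm => (tnth t p.1 : R) < tnth t p.2).
    by apply: measurable_fun_ltr; exact: measurable_tnth.
  have := mlt measurableT [set true] I.
  by congr (measurable _); apply/seteqP; split => t [_ /=].
apply/seteqP; split => [t ch [i j] /= ij|t ch i j ij]; first exact: ch.
exact: (ch (i, j)).
Qed.

Lemma chamber_sorted n (t : n.-tuple Rm) :
  chamber t <-> sorted <%R (t : seq R).
Proof.
split=> [ch|st i j ij].
  rewrite lt_sorted_pairwise; apply/(pairwiseP 0) => i j.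
  rewrite !inE size_tuple => it jt ij.
  by have := ch (Ordinal it) (Ordinal jt) ij; rewrite !(tnth_nth 0).
rewrite !(tnth_nth 0); have := lt_sorted_ltn_nth 0 st => /(_ i j).
by rewrite !inE !size_tuple !ltn_ord => ->.
Qed.

Lemma chamber_perm_exists n (t : n.-tuple Rm) : uniq (t : seq R) ->
  exists s : 'S_n, chamber (perm_tuple s t).
Proof.
move=> ut; have /tuple_permP[s ts] : perm_eq (sort <=%R (t : seq R)) t.
  by rewrite perm_sort.
exists s; apply/chamber_sorted.
have -> : perm_tuple s t = sort <=%R (t : seq R) :> seq R by rewrite ts.
by rewrite lt_sorted_uniq_le sort_uniq ut sort_le_sorted.
Qed.

Lemma chamber_uniq n (t : n.-tuple Rm) (s : 'S_n) :
  chamber (perm_tuple s t) -> uniq (t : seq R).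
Proof.
move=> /chamber_sorted/lt_sorted_uniq; congr is_true; apply: perm_uniq.
by apply/tuple_permP; exists s.
Qed.

Lemma chamber_perm_unique n (t : n.-tuple Rm) (s s' : 'S_n) :
  chamber (perm_tuple s t) -> chamber (perm_tuple s' t) -> s = s'.
Proof.
move=> ch ch'; have /tuple_uniqP inj := chamber_uniq ch.
have pst (u : 'S_n) : perm_eq (perm_tuple u t : seq R) t.
  by apply/tuple_permP; exists u.
have E : perm_tuple s t = perm_tuple s' t.
  apply: val_inj; apply: lt_sorted_eq;
    [exact/chamber_sorted|exact/chamber_sorted|].
  by move=> x; rewrite (perm_mem (pst s)) (perm_mem (pst s')).
apply/permP => i; apply: inj; have := congr1 (fun u => tnth u i) E.
by rewrite !tnth_perm_tuple.
Qed.

Lemma sum_chamber_indic n (t : n.-tuple Rm) : uniq (t : seq R) ->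
  \sum_(s : 'S_n) \1_(@chamber n) (perm_tuple s t) = 1 :> R.
Proof.
move=> /chamber_perm_exists[s ch]; rewrite (bigD1 s) //= indicE mem_set //.
rewrite big1 ?addr0 // => s' /eqP ss'; rewrite indicE memNset // => ch'.
by apply: ss'; exact: chamber_perm_unique ch' ch.
Qed.

Variables (r : nat) (w : r.*2.-tuple Rm -> R[i]).
Hypothesis w_int : cintegrable (power_measure leb r.*2) setT w.
Hypothesis w_anti : forall s t, w (perm_tuple s t) = (-1) ^+ s * w t.

(** The transposition of two equal coordinates fixes [t] but changes the sign of [w]. *)
Let w_tie (t : r.*2.-tuple Rm) : ~~ uniq (t : seq R) -> w t = 0.
Proof.
move=> /tuple_uniqP tie.
have [i [j [ij tij]]] : exists i j, i != j /\ tnth t i = tnth t j.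
  apply: contrapT => H; apply: tie => i j tij; apply: contrapT => /eqP ij.
  by apply: H; exists i, j.
have := w_anti (tperm i j) t; rewrite odd_tperm ij expr1 mulN1r.
rewrite (_ : perm_tuple _ t = t).
  by move=> /eqP; rewrite -addr_eq0 -mulr2n mulrn_eq0 => /eqP.
apply: eq_from_tnth => l; rewrite tnth_perm_tuple.
by case: tpermP => // ->; rewrite tij.
Qed.

(** The constant value of [pair_sgn] on the chamber rearranged by [s]. Summed against the sign of
    [s] it gives the unnormalised Pfaffian of [sgn_mx]. *)
Let csgn (s : 'S_r.*2) : R :=
  \prod_(i < r) sgn_mx R r.*2 (s (ord_even i)) (s (ord_odd i)).

Let pair_sgn_perm (t : r.*2.-tuple Rm) s : chamber t ->
  pair_sgn (perm_tuple s t) = csgn s.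
Proof.
move=> ch; apply: eq_bigr => i _; rewrite !tnth_perm_tuple mxE.
case: ltngtP => [lt|gt|/val_inj ->]; rewrite /= ?subr0 ?sub0r ?subrr ?sgr0 //.
- by rewrite gtr0_sg // subr_gt0; exact: ch.
- by rewrite ltr0_sg // subr_lt0; exact: ch.
Qed.

(* Almost-everywhere arguments are avoided: where two coordinates coincide no
   permutation of t is in the chamber, but there w vanishes. *)
Lemma cintegral_chamber :
  cintegral (power_measure leb r.*2) setT (fun t => (pair_sgn t)%:C * w t) =
  (2 ^ r * r`!)%:R * cintegral (power_measure leb r.*2) (@chamber r.*2) w.
Proof.
pose mu := power_measure leb r.*2.
have m1 : measurable_fun setT (\1_(@chamber r.*2) : r.*2.-tuple Rm -> R).
  by apply: measurable_indic; exact: measurable_chamber.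
have n1 (t : r.*2.-tuple Rm) : `|\1_(@chamber r.*2) t : R| <= 1.
  by rewrite indicE; case: (_ \in _); rewrite ?normr1 ?normr0.
have sw_int : cintegrable mu setT (fun t => (pair_sgn t)%:C * w t).
  apply: (cintegrable_bounded measurableT (@measurable_pair_sgn R r)) => //.
  exact: normr_pair_sgn.
have cw_int : cintegrable mu setT (fun t => (\1_(@chamber r.*2) t)%:C * w t).
  exact: (cintegrable_bounded measurableT m1 n1).
(* [G s] is the integrand on the region that s^-1 sorts, carried back to the chamber: there
   [pair_sgn] is the constant [csgn s], and antisymmetry of [w] supplies the sign. *)
pose G (s : 'S_r.*2) (t : r.*2.-tuple Rm) : R[i] :=
  ((-1) ^+ s * csgn s)%:C * ((\1_(@chamber r.*2) t)%:C * w t).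
have GE (s : 'S_r.*2) (t : r.*2.-tuple Rm) : G s (perm_tuple s^-1%g t) =
    (\1_(@chamber r.*2) (perm_tuple s^-1%g t))%:C * ((pair_sgn t)%:C * w t).
  rewrite /G indicE; case: (boolP (_ \in _)) => [|_];
    last by rewrite !mul0r mulr0.
  rewrite inE => ch; rewrite !mul1r -(pair_sgn_perm s ch) -perm_tupleM mulgV.
  rewrite perm_tuple1 w_anti odd_permV rmorphM rmorph_sign.
  by rewrite mulrACA -expr2 sqrr_sign mul1r.
have G_int (s : 'S_r.*2) : cintegrable mu setT (G s \o perm_tuple s^-1%g).
  rewrite (_ : _ \o _ = fun t : r.*2.-tuple Rm =>
    (\1_(@chamber r.*2) (perm_tuple s^-1%g t))%:C * ((pair_sgn t)%:C * w t)).
    apply: (cintegrable_bounded measurableT (h := \1_(@chamber r.*2) \o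
      perm_tuple s^-1%g)) => //.
      exact: measurableT_comp m1 (measurable_perm_tuple s^-1%g).
    by move=> t; exact: n1.
  by apply/funext => t; rewrite -GE.
transitivity (cintegral mu setT (fun t =>
    \sum_(s : 'S_r.*2) G s (perm_tuple s^-1%g t))).
  apply: eq_cintegral => t _; under eq_bigr do rewrite GE.
  rewrite -mulr_suml; have [ut|nut] := boolP (uniq (t : seq R)); last first.
    by rewrite w_tie // !mulr0.
  rewrite (reindex (fun s : 'S_r.*2 => s^-1%g)) /=; last first.
    by exists (fun s : 'S_r.*2 => s^-1%g) => s _; rewrite invgK.
  under eq_bigr do rewrite invgK.
  by rewrite -rmorph_sum (sum_chamber_indic ut) mul1r.
rewrite (cintegral_sum measurableT _ (fun s : 'S_r.*2 => G_int s)).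
transitivity (\sum_(s : 'S_r.*2) ((-1) ^+ s * csgn s)%:C *
    cintegral mu (@chamber r.*2) w).
  apply: eq_bigr => s _; rewrite (cintegral_perm (s := s^-1%g) (G_int s)) /G.
  by rewrite (cintegralZ measurableT) // -cintegral_mkcond.
rewrite -mulr_suml -rmorph_sum /=; congr (_ * _).
have -> : \sum_(s : 'S_r.*2) (-1) ^+ s * csgn s = (2 ^ r * r`!)%:R.
  exact: (alt_pairs_sgn R r).
by rewrite rmorph_nat.
Qed.
End Chamber.

(** * The eigenvalue density as an alternating sum *)

Lemma pfaffianE (K : comUnitRingType) n (A : 'M[K]_n.*2) :
  pfaffian A = (2 ^ n * n`!)%:R^-1 * alt_pairs (fun _ : 'I_n => A).
Proof.
rewrite /pfaffian doubleK; congr (_ * _); apply: eq_bigr => s _; congr (_ * _).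
rewrite big_mkcond prod_double; apply: eq_bigr => i _ /=.
rewrite !odd_double /= mulr1; congr (A _ (s _)); apply: ord_inj => /=.
by rewrite modn_small // ltn_Sdouble.
Qed.

Fact widen_pairs_subproof r m : (r.*2 <= (r + m).*2)%N.
Proof. by rewrite leq_double leq_addr. Qed.

Definition widen_pairs r m : 'I_r.*2 -> 'I_(r + m).*2 :=
  widen_ord (widen_pairs_subproof r m).

Lemma widen_pairs_even r m (i : 'I_r) :
  widen_pairs m (ord_even i) = ord_even (lshift m i).
Proof. exact: ord_inj. Qed.

Lemma widen_pairs_odd r m (i : 'I_r) :
  widen_pairs m (ord_odd i) = ord_odd (lshift m i).
Proof. exact: ord_inj. Qed.

Section Density.
Variable R : realType.

Lemma eig_density_expand r m (p : nat -> {poly R[i]})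
    (e : 'I_r.*2 -> R[i]) (w : 'I_m -> R[i]) :
  (forall j, (j < (r + m).*2)%N -> p j \is monic /\ size (p j) = j.+1) ->
  let N := (r + m).*2 in let q := qpol N p in
  eig_density N e w =
  dens_const R N r.*2 * (-1) ^+ 'C(m, 2) * (-1) ^+ 'C(r + m, 2) *
  (2 ^ m)%:R^-1 *
  \sum_(s : 'S_(r + m).*2) (-1) ^+ s *
    ((\prod_(j < r.*2) (tau N (e j) * (q (s (widen_pairs m j))).[e j])) *
     \prod_(i < m) (tau N (w i) * tau N ((w i)^*)%C^-1 / `|w i| ^+ 2 *
       ((q (s (ord_even (rshift r i)))).[w i] *
        (q (s (ord_odd (rshift r i)))).[((w i)^*)%C^-1] -
        (q (s (ord_odd (rshift r i)))).[w i] *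
        (q (s (ord_even (rshift r i)))).[((w i)^*)%C^-1]))).
Proof.
move=> p_monic N q.
pose eN i : R[i] := oapp e 0 (insub i).
pose wN i : R[i] := oapp w 0 (insub i).
pose wN' i : R[i] := ((wN i)^*)%C^-1.
have eE i : e i = eN i by rewrite /eN valK.
have wE i : w i = wN i by rewrite /wN valK.
(* Since r.*2 is even, the parity of i itself tells w from w'. *)
pose y i : R[i] := if (i < r.*2)%N then eN i else
  if odd i then wN' (i - r.*2)./2 else wN (i - r.*2)./2.
have yr i : (i < r.*2)%N -> y i = eN i by rewrite /y => ->.
have yw i : y (r.*2 + i.*2)%N = wN i.
  by rewrite /y ltnNge leq_addr /= oddD !odd_double /= addKn doubleK.
have yw' i : y (r.*2 + i.*2).+1 = wN' i.
  rewrite /y ltnNge leqW ?leq_addr //= oddD !odd_double /=.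
  by rewrite -addnS addKn /= uphalf_double.
pose M (i : 'I_(r + m)) : 'M[R[i]]_((r + m).*2) :=
  \matrix_(j, l) ((q j).[y i.*2] * (q l).[y i.*2.+1]).
(* Grouping the rows two by two in the Leibniz formula turns the determinant into [alt_pairs] of
   rank-one matrices. *)
have det_M : \det (\matrix_(i < N, l < N) (q l).[y i]) = alt_pairs M.
  apply: eq_bigr => s _; congr (_ * _); rewrite prod_double.
  by apply: eq_bigr => i _; rewrite !mxE.
(* Only the pairs of complex points are antisymmetrised; each doubles the sum, whence the factor
   2^-m. *)
pose P : {set 'I_(r + m)} := [set rshift r i | i : 'I_m]%SET.
have asym := alt_pairs_asym M P.
rewrite card_imset ?cardsT ?card_ord in asym; last exact: rshift_inj.
have vdm_y := det_flip_odd_poly (n := r + m) (q := q) y p_monic.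
rewrite -/N det_M in vdm_y.
have {}vdm_y := vdm_y (fun l => erefl).
have N_E : N = (r.*2 + m.*2)%N by rewrite -doubleD.
have inter := diff_prod_interleave (k := r.*2) (m := m) (y := y) (fun s _ => yw
  s) (fun s _ => yw' s).
rewrite -N_E in inter.
set D := _ * _ * _ * _ in inter.
have DE : D = (-1) ^+ 'C(m, 2) * (-1) ^+ 'C(r + m, 2) * (2 ^ m)%:R^-1 *
    alt_pairs (fun i => if i \in P then M i - (M i)^T else M i).
  rewrite asym vdm_y inter -[X in _ = _ * X]mulr_natr.
  have n0 : (2 ^ m)%:R != 0 :> R[i] by rewrite pnatr_eq0 expn_eq0.
  have c1 := sqrr_sign R[i] 'C(m, 2); have c2 := sqrr_sign R[i] 'C(r + m, 2).
  rewrite expr2 in c1; rewrite expr2 in c2.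
  transitivity (((-1) ^+ 'C(m, 2) * (-1) ^+ 'C(m, 2)) *
    ((-1) ^+ 'C(r + m, 2) * (-1) ^+ 'C(r + m,
      2)) * ((2 ^ m)%:R^-1 * (2 ^ m)%:R) * D).
    by rewrite c1 c2 mulVf // !mul1r.
  have key (a b x x' z : R[i]) :
    (a * a) * (b * b) * (x' * x) * z = a * b * x' * (b * (a * z) * x) by ring.
  exact: key.
rewrite /eig_density; move: (dens_const R N r.*2) => dc.
rewrite -!mulrA; congr (_ * _).
transitivity ((\prod_(j < r.*2) tau N (e j)) *
  (\prod_(s < m) (tau N (w s) * tau N ((w s)^*)%C^-1 / `|w s| ^+ 2)) * D).
  rewrite -!mulrA; congr (_ * (_ * _)); rewrite /D !mulrA;
    congr (_ * _ * _ * _).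
  - rewrite /diff_prod -prod_ord_lt; apply: eq_bigr => j _;
    apply: eq_bigr => i _.
    by rewrite !eE !yr.
  - rewrite big_mkord; apply: eq_bigr => j _; rewrite big_mkord.
    by apply: eq_bigr => i _; rewrite eE wE yr.
  - rewrite -prod_ord_lt; apply: eq_bigr => j _; apply: eq_bigr => i _.
    by rewrite !wE.
  - rewrite big_mkord; apply: eq_bigr => j _; rewrite big_mkord.
    by apply: eq_bigr => i _; rewrite !wE.
rewrite DE -!mulrA [LHS]mulrA [LHS]mulrCA; congr (_ * _).
rewrite [LHS]mulrCA; congr (_ * _); rewrite [LHS]mulrCA; congr (_ * _).
rewrite mulr_sumr; apply: eq_bigr => s _; rewrite [LHS]mulrCA; congr (_ * _).
rewrite [X in _ * X = _]big_split_ord /= mulrACA; congr (_ * _).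
  rewrite [in RHS]big_split /=; congr (_ * _).
  rewrite prod_double; apply: eq_bigr => i _.
  have -> : (lshift m i \in P) = false.
    by apply/imsetP => -[j _ /eqP]; rewrite eq_lrshift.
  by rewrite mxE /= widen_pairs_even widen_pairs_odd !eE /= !yr // ?ltn_Sdouble
    ?ltn_double.
rewrite -big_split; apply: eq_bigr => i _; congr (_ * _).
have -> : rshift r i \in P by rewrite imset_f.
have y1 : y (r + i).*2 = wN i by rewrite doubleD yw.
have y2 : y (r + i).*2.+1 = wN' i by rewrite doubleD yw'.
by rewrite !mxE /= y1 y2 wE.
Qed.
End Density.

(** * Integrating out the eigenvalues *)

Lemma alternating_perm_tuple (K : pzRingType) T n (w : n.-tuple T -> K) :
  (forall i j t, i != j -> w (perm_tuple (tperm i j) t) = - w t) ->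
  forall (s : 'S_n) t, w (perm_tuple s t) = (-1) ^+ s * w t.
Proof.
move=> w_alt s; case: (prod_tpermP s) => ts -> {s}.
elim: ts => [|[i j] ts IH] /= => [_ t|/andP[ij ts_ne] t].
  by rewrite big_nil perm_tuple1 odd_perm1 mul1r.
rewrite big_cons perm_tupleM w_alt // IH // odd_mul_tperm ij.
by rewrite signr_addb expr1 !mulN1r mulNr.
Qed.

Lemma indic_power (T : Type) (R : numDomainType) n (D : set T)
    (t : n.-tuple T) :
  \1_[set t : n.-tuple T | forall i, D (tnth t i)] t =
  \prod_(i < n) \1_D (tnth t i) :> R.
Proof.
rewrite indicE; have [|] := boolP (_ \in _).
  rewrite inE /= => Dt; rewrite big1 // => i _; rewrite indicE mem_set //.
rewrite notin_setE /= => /existsNP[i Di].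
by rewrite (bigD1 i) //= indicE memNset // mul0r.
Qed.

Section PowerSum.
Context d (T : measurableType d) (R : realType).
Variable mu : {sigma_finite_measure set T -> \bar R}.

(** The indicator of a power of [D] is a product of indicators, so it is absorbed into the factors
    one by one. *)
Lemma cintegral_power_on (I : finType) n (D : set T) (C : I -> R[i])
    (f : I -> 'I_n -> T -> R[i]) : measurable D ->
  (forall s i, cintegrable mu D (f s i)) ->
  cintegral (power_measure mu n) [set t | forall i, D (tnth t i)]
    (fun t => \sum_s C s * \prod_(i < n) f s i (tnth t i)) =
  \sum_s C s * \prod_(i < n) cintegral mu D (f s i).
Proof.
move=> mD f_int; rewrite cintegral_mkcond.
pose g s i x := (\1_D x)%:C * f s i x.
have g_int s i : cintegrable mu setT (g s i) by exact: cintegrable_mkcond.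
have gp_int s := cintegral_power_prod (g_int s).
transitivity (cintegral (power_measure mu n) setT
    (fun t => \sum_s C s * \prod_(i < n) g s i (tnth t i))).
  apply: eq_cintegral => t _; rewrite indic_power mulr_sumr.
  apply: eq_bigr => s _; rewrite mulrCA rmorph_prod /=; congr (_ * _).
  by rewrite -big_split.
rewrite (cintegral_sum measurableT); last first.
  by move=> s; apply: (cintegrableZ measurableT); exact: (gp_int s).1.
apply: eq_bigr => s _; rewrite (cintegralZ measurableT);
  last exact: (gp_int s).1.
rewrite (gp_int s).2; congr (_ * _); apply: eq_bigr => i _.
by rewrite -cintegral_mkcond.
Qed.
End PowerSum.

Section DeBruijn.
Variables (R : realType) (r m : nat).
Local Notation leb := (@lebesgue_measure R).
Local Notation Rm := (measurableTypeR R).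
Variables (a : 'I_(r + m).*2 -> Rm -> R[i]) (B : 'M[R[i]]_((r + m).*2)).
Hypothesis a_int : forall j, cintegrable leb setT (a j).

(* The sum over permutations once the w-variables are integrated out. *)
Definition mixed_det (t : r.*2.-tuple Rm) : R[i] :=
  \sum_(s : 'S_(r + m).*2) (-1) ^+ s *
    ((\prod_(j < r.*2) a (s (widen_pairs m j)) (tnth t j)) *
     \prod_(i < m) B (s (ord_even (rshift r i))) (s (ord_odd (rshift r i)))).

(** Exchanging two angles amounts to exchanging two positions below 2r in the sum; the positions
    belonging to the w's lie above and do not move. *)
Lemma mixed_det_perm (s : 'S_r.*2) t :
  mixed_det (perm_tuple s t) = (-1) ^+ s * mixed_det t.
Proof.
apply: alternating_perm_tuple => {s}i j {}t ij.
pose u := tperm (widen_pairs m i) (widen_pairs m j).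
have emb_inj : injective (@widen_pairs r m) by move=> x y /(congr1 val) /=
  /val_inj.
have emb_neq (x : 'I_r.*2) (y : 'I_(r + m).*2) : (r.*2 <= y)%N -> widen_pairs m
  x != y.
  move=> ry; apply/eqP => /(congr1 val) /= xy.
  by move: (ltn_ord x); rewrite xy ltnNge ry.
rewrite /mixed_det (reindex_inj (mulgI u)) -sumrN; apply: eq_bigr => s _ /=.
rewrite odd_mul_tperm (inj_eq emb_inj) ij signr_addb expr1 mulN1r mulNr.
congr (- (_ * (_ * _))).
  rewrite (reindex_inj (@perm_inj _ (tperm i j))) /=; apply: eq_bigr => l _.
  rewrite tnth_perm_tuple tpermK permM /u -(inj_tperm _ _ _ emb_inj).
  by rewrite tpermK.
apply: eq_bigr => l _; rewrite !permM !tpermD //; apply: emb_neq => /=.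
- by rewrite doubleD leqW // leq_addr.
- by rewrite doubleD leqW // leq_addr.
- by rewrite doubleD leq_addr.
- by rewrite doubleD leq_addr.
Qed.

Let prod_int (s : 'S_(r + m).*2) := cintegral_power_prod
  (f := fun j : 'I_r.*2 => a (s (widen_pairs m j))) (fun j => a_int _).

Lemma cintegrable_mixed_det :
  cintegrable (power_measure leb r.*2) setT mixed_det.
Proof.
apply: (cintegrable_sum measurableT) => s.
under eq_fun do rewrite mulrCA mulrC -mulrA.
do 2 apply: (cintegrableZ measurableT).
exact: (prod_int s).1.
Qed.

Lemma cintegral_chamber_mixed_det :
  (2 ^ r * r`!)%:R *
  cintegral (power_measure leb r.*2) (@chamber R r.*2) mixed_det =
  alt_pairs (fun i : 'I_(r + m) =>
    if (i < r)%N then \matrix_(j, l) sgn_int (a j) (a l) else B).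
Proof.
rewrite -(cintegral_chamber cintegrable_mixed_det mixed_det_perm).
pose b (s : 'S_(r + m).*2) := (-1) ^+ s *
  \prod_(i < m) B (s (ord_even (rshift r i))) (s (ord_odd (rshift r i))).
have term_int (s : 'S_(r + m).*2) : cintegrable (power_measure leb r.*2) setT
    (fun t => (pair_sgn t)%:C * \prod_(j < r.*2) a (s (widen_pairs m j)) (tnth
      t j)).
  apply: (cintegrable_bounded measurableT (@measurable_pair_sgn R r)).
    exact: normr_pair_sgn.
  exact: (prod_int s).1.
transitivity (cintegral (power_measure leb r.*2) setT (fun t =>
    \sum_(s : 'S_(r + m).*2) b s *
      ((pair_sgn t)%:C * \prod_(j < r.*2) a (s (widen_pairs m j)) (tnth t j)))).
  apply: eq_cintegral => t _; rewrite mulr_sumr; apply: eq_bigr => s _.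
  by rewrite [RHS]mulrCA; congr (_ * _); rewrite /b mulrAC -mulrA.
rewrite (cintegral_sum measurableT) => [|s];
  last exact: (cintegrableZ measurableT).
apply: eq_bigr => s _; rewrite (cintegralZ measurableT) //.
rewrite (cintegral_pairs (a := fun j => a (s (widen_pairs m j))) (fun j =>
  a_int _)).
rewrite /b -mulrA; congr (_ * _); rewrite big_split_ord /= mulrC.
congr (_ * _); apply: eq_bigr => i _; last by rewrite ltnNge leq_addr.
by rewrite ltn_ord mxE widen_pairs_even widen_pairs_odd.
Qed.
End DeBruijn.

Section RealPairs.
Variable R : realType.
Local Notation leb := (@lebesgue_measure R).
Local Notation Rm := (measurableTypeR R).

Lemma cintegrable_of_mkcond d (T : measurableType d)
    (mu : {measure set T -> \bar R}) (D : set T) (f : T -> R[i]) :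
  measurable D -> cintegrable mu setT (fun x => (\1_D x)%:C * f x) ->
  cintegrable mu D f.
Proof.
move=> mD [fr fi]; split; [have := fr|have := fi];
  move=> /(@integrableS _ _ _ _ _ _ _ measurableT mD (@subsetT _ _));
  by apply: eq_integrable => // x Dx; rewrite /= indicE Dx mul1r.
Qed.

Lemma cintegral_itv_oo (x y : R) (f : Rm -> R[i]) :
  cintegrable leb `]x, y[ f ->
  cintegral leb `[x, y] f = cintegral leb `]x, y[ f.
Proof.
move=> [fr fi]; congr (_ +i* _); rewrite /Rintegral; congr fine.
  exact: (integral_itv_bndoo true false (measurable_int _ fr)).
exact: (integral_itv_bndoo true false (measurable_int _ fi)).
Qed.

Lemma cintegrable_subitv (x y : R) (f : Rm -> R[i]) :
  cintegrable leb `[x, y] f -> cintegrable leb `]x, y[ f.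
Proof.
move=> [fr fi]; split; [apply: integrableS fr|apply: integrableS fi] => //;
  exact: subset_itv_oo_cc.
Qed.

(* The partition function has angles in an open interval,
  alpha in a closed one. *)
Definition itv_restrict (x y : R) (f : Rm -> R[i]) : Rm -> R[i] :=
  fun t => (\1_(`]x, y[%classic : set Rm) t)%:C * f t.

Lemma cintegrable_itv_restrict (x y : R) (f : Rm -> R[i]) :
  cintegrable leb `[x, y] f -> cintegrable leb setT (itv_restrict x y f).
Proof.
by move=> f_int; apply: cintegrable_mkcond => //; exact: cintegrable_subitv.
Qed.

Lemma sgn_int_itv (x y : R) (f g : Rm -> R[i]) :
  cintegrable leb `[x, y] f -> cintegrable leb `[x, y] g ->
  cintegral leb `[x, y] (fun s => f s *
    cintegral leb `[x, y] (fun t => g t * (Num.sg (t - s))%:C)) =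
  sgn_int (itv_restrict x y f) (itv_restrict x y g).
Proof.
move=> f_int g_int.
have inner s : cintegral leb `[x, y] (fun t => g t * (Num.sg (t - s))%:C) =
    cintegral leb setT (fun t => (Num.sg (t - s))%:C * itv_restrict x y g t).
  under eq_cintegral do rewrite mulrC.
  rewrite cintegral_itv_oo; last first.
    apply: cintegrable_bounded; [by []| |by move=> t; exact: normr_sg_le1|].
      exact: measurable_funS (measurable_sgB1 s).
    exact: cintegrable_subitv.
  by rewrite cintegral_mkcond; apply: eq_cintegral => t _; rewrite mulrCA.
under eq_cintegral do rewrite inner.
have S_int := sgn_int_inner (cintegrable_itv_restrict f_int)
  (cintegrable_itv_restrict g_int).
rewrite cintegral_itv_oo; last first.
  apply: cintegrable_of_mkcond => //.
  by move: S_int; congr cintegrable; apply/funext => s; rewrite mulrA.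
rewrite cintegral_mkcond; apply: eq_cintegral => s _.
by rewrite mulrA.
Qed.
End RealPairs.

(** * Constants and conclusion *)

Section Constants.
Variable R : realType.

Lemma expiD (x y : R) : expi (x + y) = expi x * expi y.
Proof. by rewrite /expi; simpc; rewrite cosD sinD [X in _ +i* X]addrC. Qed.

Lemma signpowD (x y : R) : signpow (x + y) = signpow x * signpow y.
Proof. by rewrite /signpow mulrDr expiD. Qed.

Lemma signpow1 : signpow 1 = -1 :> R[i].
Proof. by rewrite /signpow mulr1 /expi cospi sinpi; simpc. Qed.

Lemma signpow_half : signpow 2^-1 = 'i%C :> R[i].
Proof. by rewrite /signpow /expi cos_pihalf sin_pihalf. Qed.

Lemma signpow0 : signpow 0 = 1 :> R[i].
Proof. by rewrite /signpow mulr0 /expi cos0 sin0. Qed.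

Lemma signpowMn (x : R) n : signpow (n%:R * x) = signpow x ^+ n.
Proof.
elim: n => [|n IHn]; first by rewrite mul0r signpow0.
by rewrite -addn1 natrD mulrDl mul1r signpowD IHn exprD.
Qed.

Lemma signpow_nat n : signpow n%:R = (-1) ^+ n :> R[i].
Proof. by rewrite -[n%:R]mulr1 signpowMn signpow1. Qed.

Lemma natr_bin2 n : (n%:R * (n%:R - 1)) / 2 = 'C(n, 2)%:R :> R.
Proof.
elim: n => [|n IHn]; first by rewrite !mul0r.
by rewrite binS bin1 natrD -IHn -addn1 natrD; field.
Qed.

(* With k = 2r, A_{k,N} contributes (-i)^r 2^(-r), which is also what the factor
   -i/2 of alpha contributes to the Pfaffian. *)
Lemma signpow_dens r m :
  let N : R := ((r + m).*2)%:R in let k : R := (r.*2)%:R in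
  let h := (N - k) / 2 in
  signpow (h * (h - 1) / 2 + (N - k) * k / 2 - k * (k - 1) / 4) =
  (-1) ^+ 'C(m, 2) * (- 'i%C) ^+ r :> R[i].
Proof.
move=> N k h.
have hE : h = m%:R.
  by rewrite /h /N /k doubleD natrD -!mul2n !natrM; field.
have NkE : N - k = 2 * m%:R by rewrite -hE /h; field.
have kE : k = 2 * r%:R by rewrite /k -mul2n natrM.
rewrite hE natr_bin2 NkE kE.
(* The four terms contribute (-1)^'C(m, 2), then 1, then (-1)^(r r) = (-1)^r, and i^r; the last two
   combine to (-i)^r. *)
have -> : 'C(m, 2)%:R + 2 * m%:R * (2 * r%:R) / 2 - 2 * r%:R * (2 * r%:R - 1) /
  4 =
   'C(m, 2)%:R + (m * r)%:R * 2 + (- (r * r)%:R + r%:R * 2^-1) :> R.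
  by rewrite !natrM; field.
rewrite !signpowD signpow_nat signpowMn signpowMn signpow_half.
have -> : signpow 2 = 1 :> R[i].
  by rewrite (signpow_nat 2) sqrrN expr1n.
rewrite expr1n mulr1; congr (_ * _); rewrite [RHS]exprNn; congr (_ * _).
have E : signpow (- (r * r)%:R) * signpow (r * r)%:R = 1 :> R[i].
  by rewrite -signpowD addNr signpow0.
rewrite signpow_nat -signr_odd oddM andbb signr_odd in E.
by rewrite -[LHS]mulr1 -[X in _ * X](sqrr_sign R[i] r) expr2 mulrA E mul1r.
Qed.
End Constants.

Lemma alt_pairs_scale (K : comPzRingType) n (c : 'I_n -> K)
    (M : 'I_n -> 'M[K]_n.*2) :
  alt_pairs (fun i => c i *: M i) = (\prod_(i < n) c i) * alt_pairs M.
Proof.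
rewrite /alt_pairs mulr_sumr; apply: eq_bigr => s _; rewrite mulrCA;
  congr (_ * _).
by rewrite -big_split; apply: eq_bigr => i _; rewrite mxE.
Qed.

Lemma pfaffian_coef (K : fieldType) r m (A B : 'M[K]_((r + m).*2)) :
  (pfaffian (\matrix_(j < (r + m).*2, l < (r + m).*2)
     ('X^2 * (A j l)%:P + (B j l)%:P)))`_r.*2 =
  (2 ^ (r + m) * (r + m)`!)%:R^-1 *
  (alt_pairs (fun i : 'I_(r + m) => if (i < r)%N then A else B) *+ 'C(r + m,
    r)).
Proof.
rewrite pfaffianE -polyC_natr polyCV coefCM; congr (_ * _).
exact: alt_pairs_coef.
Qed.

Section Partition.
Variable R : realType.
Local Notation leb := (@lebesgue_measure R).
Local Notation Rm := (measurableTypeR R).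

Lemma measurable_Omega : measurable (@Omega R).
Proof.
have mlt : measurable_fun setT (fun z : plane R => z.1 * z.1 + z.2 * z.2 < (1 :
  R)).
  apply: measurable_fun_ltr; last exact: measurable_cst.
  apply: measurable_funD; apply: measurable_funM;
    by [exact: measurable_fst|exact: measurable_snd].
have := mlt measurableT [set true] I; congr (measurable _).
have normE (z : plane R) : (ComplexField.Normc.normc (toC z) < 1) =
  (z.1 * z.1 + z.2 * z.2 < 1).
  have := ltr_sqrt (z.1 ^+ 2 + z.2 ^+ 2) (@ltr01 R).
  by rewrite sqrtr1 -!expr2 => <-.
by apply/seteqP; split => z; rewrite /Omega /= normE //; case.
Qed.

Lemma indic_ordered_angles n (t : n.-tuple Rm) :
  \1_(@ordered_angles R n) t =
  \1_(@chamber R n) t *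
  \prod_(i < n) \1_(`]0, 2 * pi[%classic : set Rm) (tnth t i) :> R.
Proof.
rewrite -indic_power -[RHS]/((\1_(@chamber R n) \* \1_[set t0 : n.-tuple Rm |
  forall i, (`]0, 2 * pi[%classic : set Rm) (tnth t0 i)]) t) -indicI.
congr (\1_ _ t); apply/seteqP; split => x /=.
  by move=> [x0 xlt]; split => // i; rewrite in_itv /=; exact: x0.
by move=> [xlt x0]; split => // i; have := x0 i; rewrite in_itv.
Qed.

Variables (r m : nat) (p : nat -> {poly R[i]}) (u v : R[i] -> R[i]).
Let N := (r + m).*2.
Let q := qpol N p.
Hypothesis p_monic : forall j, (j < N)%N -> p j \is monic /\ size (p j) = j.+1.
Hypothesis u_int : forall j, (j < N)%N ->
  cintegrable leb `[0, 2 * pi] (alpha_weight N u (q j)).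
Hypothesis v_int : forall j l, (j < N)%N -> (l < N)%N ->
  cintegrable (plane_measure R) (Omega (R:=R)) (beta_integrand N v (q j) (q l)).

Let a (l : 'I_N) : Rm -> R[i] :=
  itv_restrict 0 (2 * pi) (alpha_weight N u (q l)).
Let B : 'M[R[i]]_N := \matrix_(j, l) beta N v (q j) (q l).
Let A : 'M[R[i]]_N := \matrix_(j, l) alpha N u (q j) (q l).
(** Besides A_{k,N}: the sign of the interleaving, the sign of the column reordering, and 2^-m from
    antisymmetrising m pairs. *)
Let dc : R[i] := dens_const R N r.*2 * (-1) ^+ 'C(m, 2) * (-1) ^+ 'C(r + m, 2) *
  (2 ^ m)%:R^-1.

Let a_int l : cintegrable leb setT (a l).
Proof. exact/cintegrable_itv_restrict/u_int. Qed.

Let integrated_density (e : 'I_r.*2 -> R[i]) :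
  cintegral (power_measure (plane_measure R) m) (@Omega_power R m)
    (fun z => (\prod_(s < m) v (toC (tnth z s))) *
       eig_density N e (fun s : 'I_m => toC (tnth z s))) =
  dc * \sum_(s : 'S_N) (-1) ^+ s *
    ((\prod_(j < r.*2) (tau N (e j) * (q (s (widen_pairs m j))).[e j])) *
     \prod_(i < m) B (s (ord_even (rshift r i))) (s (ord_odd (rshift r i)))).
Proof.
pose C (s : 'S_N) := dc * ((-1) ^+ s *
  (\prod_(j < r.*2) (tau N (e j) * (q (s (widen_pairs m j))).[e j]))).
pose f (s : 'S_N) (i : 'I_m) := beta_integrand N v
  (q (s (ord_even (rshift r i)))) (q (s (ord_odd (rshift r i)))).
have f_int s i : cintegrable (plane_measure R) (@Omega R) (f s i) by exact:
  v_int.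
have E := cintegral_power_on C measurable_Omega f_int.
transitivity (\sum_s C s * \prod_(i < m) cintegral (plane_measure R) (@Omega R)
  (f s i)).
  rewrite -E; apply: eq_cintegral => z _.
  rewrite (eig_density_expand _ _ p_monic) -/N -/q -/dc mulrCA mulr_sumr
    mulr_sumr.
  apply: eq_bigr => s _; rewrite /C; generalize dc => c.
  rewrite -!mulrA; congr (_ * _).
  rewrite mulrCA; congr (_ * _); rewrite mulrCA; congr (_ * _).
  have assoc (x y y' n X : R[i]) : x * (y * y' / n * X) = x * y * y' / n * X.
    by rewrite !mulrA.
  by rewrite -big_split; apply: eq_bigr => i _; exact: assoc.
rewrite mulr_sumr; apply: eq_bigr => s _; rewrite /C; generalize dc => c.
rewrite -!mulrA; congr (_ * (_ * (_ * _))).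
by apply: eq_bigr => i _; rewrite mxE.
Qed.

Lemma gen_partition_mixed_det :
  gen_partition N r.*2 u v = (m`!)%:R^-1 *
  (dc * cintegral (power_measure leb r.*2) (@chamber R r.*2) (mixed_det a B)).
Proof.
have mE : ((N - r.*2)./2 = m)%N by rewrite /N doubleD addKn doubleK.
rewrite /gen_partition mE; congr (_ * _).
rewrite cintegral_mkcond [in RHS]cintegral_mkcond -(cintegralZ measurableT);
  last first.
  apply: (cintegrable_bounded measurableT).
  - by apply: measurable_indic; exact: measurable_chamber.
  - by move=> t; rewrite indicE; case: (_ \in _); rewrite ?normr1 ?normr0.
  - exact: cintegrable_mixed_det.
apply: eq_cintegral => t _; rewrite integrated_density indic_ordered_angles.
generalize dc => c; set sigma := \sum_s _.
(* The values of [u] and the interval indicators are common to all permutations; distributed over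
   the angles, they complete the weights [a]. *)
have -> : mixed_det a B t =
    (\prod_(i < r.*2) \1_(`]0, 2 * pi[%classic : set Rm) (tnth t i))%:C *
    (\prod_(l < r.*2) u (expi (tnth t l))) * sigma.
  rewrite mulr_sumr; apply: eq_bigr => s _; rewrite [RHS]mulrCA; congr (_ * _).
  rewrite [RHS]mulrA; congr (_ * _); rewrite rmorph_prod -!big_split.
  have assoc (x y z y' : R[i]) : x * (y * z * y') = x * y * (z * y') by ring.
  by apply: eq_bigr => j _; exact: assoc.
have swap (x y z s : R[i]) : x * y * (z * (c * s)) =
  c * (x * (y * z * s)) by ring.
by rewrite rmorphM; exact: swap.
Qed.

Lemma alpha_sgn_int j l : A j l = - ('i%C / 2) * sgn_int (a j) (a l).
Proof. by rewrite mxE /alpha -sgn_int_itv //; exact: u_int. Qed.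

Lemma gen_partition_alt_pairs :
  gen_partition N r.*2 u v = (m`!)%:R^-1 * (dc * ((2 ^ r * r`!)%:R^-1 *
  alt_pairs (fun i : 'I_(r + m) =>
    if (i < r)%N then \matrix_(j, l) sgn_int (a j) (a l) else B))).
Proof.
rewrite gen_partition_mixed_det -cintegral_chamber_mixed_det //.
by rewrite mulKf // pnatr_eq0 -lt0n muln_gt0 expn_gt0 fact_gt0.
Qed.

Lemma pfaffian_alpha_beta_coef :
  (pfaffian (\matrix_(j < N, l < N)
     ('X^2 * (alpha N u (q j) (q l))%:P + (beta N v (q j) (q l))%:P)))`_r.*2 =
  (2 ^ (r + m) * (r + m)`!)%:R^-1 * ('C(r + m, r)%:R * ((- ('i%C / 2)) ^+ r *
  alt_pairs (fun i : 'I_(r + m) =>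
    if (i < r)%N then \matrix_(j, l) sgn_int (a j) (a l) else B))).
Proof.
rewrite (_ : (\matrix_(j < N, l < N) _) =
    (\matrix_(j < N, l < N) ('X^2 * (A j l)%:P + (B j l)%:P))); last first.
  by apply/matrixP => j l; rewrite !mxE.
rewrite pfaffian_coef -[X in _ * X = _]mulr_natl; congr (_ * (_ * _)).
(* Multilinearity pulls the factor -i/2 out of each of the r alpha pairs. *)
pose c (i : 'I_(r + m)) : R[i] := if (i < r)%N then - ('i%C / 2) else 1.
have -> : (- ('i%C / 2)) ^+ r = \prod_(i < r + m) c i :> R[i].
  rewrite big_split_ord /= [X in _ = _ * X]big1 => [|i _].
    rewrite mulr1 (eq_bigr (fun=> - ('i%C / 2))) ?prodr_const ?card_ord // => i
      _.
    by rewrite /c /= ltn_ord.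
  by rewrite /c /= ltnNge leq_addr.
rewrite -alt_pairs_scale; apply: eq_alt_pairs => i; rewrite /c.
case: ifP => _; last by rewrite scale1r.
by apply/matrixP => j l; rewrite alpha_sgn_int !mxE.
Qed.
End Partition.

(** The part of A_{k,N} that does not depend on k, equal to the constant of the theorem up to its
    sign. *)
Definition gamma_const (R : realType) (N : nat) : R :=
  Gamma ((N%:R + 1) / 2) `^ (N%:R / 2) * Gamma (N%:R / 2 + 1) `^ (N%:R / 2)
   / 2 `^ (N%:R * (N%:R - 1) / 2)
   * \prod_(1 <= s < N.+1) (Gamma (s%:R / 2) ^+ 2)^-1.

Lemma dens_constE (R : realType) r m : dens_const R (r + m).*2 r.*2 =
  (-1) ^+ 'C(m, 2) * (- 'i%C) ^+ r * (2 ^+ r)^-1 * (gamma_const R (r +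
    m).*2)%:C.
Proof.
rewrite /dens_const signpow_dens -[RHS]mulrA; congr (_ * _).
have -> : (2 ^+ r)^-1 = ((2 ^+ r)^-1)%:C :> R[i].
  by rewrite fmorphV rmorphXn rmorph_nat.
rewrite -rmorphM; congr (_%:C); rewrite /gamma_const.
have -> : (2 : R) `^ (((r + m).*2%:R * ((r + m).*2%:R - 1) + r.*2%:R) / 2) =
    2 `^ ((r + m).*2%:R * ((r + m).*2%:R - 1) / 2) * 2 ^+ r.
  rewrite [X in _ `^ X]mulrDl powRD; last by rewrite pnatr_eq0 implybT.
  have -> : r.*2%:R / 2 = r%:R :> R by rewrite -mul2n natrM mulrAC divff ?mul1r.
  by rewrite powR_mulrn.
rewrite invfM.
have swap (g x y z : R) : g * (x * y) * z = y * (g * x * z) by ring.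
exact: swap.
Qed.

Unset Implicit Arguments.

Theorem proposition6p8 (R : realType) (N k : nat)
  (N_even : ~~ odd N) (k_even : ~~ odd k) (k_le_N : (k <= N)%N)
  (p : nat -> {poly R[i]})
  (p_monic : forall j, (j < N)%N -> p j \is monic /\ size (p j) = j.+1)
  (u v : R[i] -> R[i])
  (u_int : forall j, (j < N)%N ->
     cintegrable (@lebesgue_measure R) `[0, 2 * pi]
       (alpha_weight N u (qpol N p j)))
  (v_int : forall j l, (j < N)%N -> (l < N)%N ->
     cintegrable (plane_measure R) (Omega (R:=R))
       (beta_integrand N v (qpol N p j) (qpol N p l))) :
  gen_partition N k u v =
  signpow ((N%:R / 2) * (N%:R / 2 - 1) / 2) *
  (Gamma ((N%:R + 1) / 2 : R) `^ (N%:R / 2) * Gamma (N%:R / 2 + 1) `^ (N%:R / 2)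
   / 2 `^ (N%:R * (N%:R - 1) / 2)
   * \prod_(1 <= s < N.+1) (Gamma (s%:R / 2) ^+ 2)^-1)%:C *
  (pfaffian (\matrix_(j < N, l < N)
     ('X^2 * (alpha N u (qpol N p j) (qpol N p l))%:P
      + (beta N v (qpol N p j) (qpol N p l))%:P)))`_k.
Proof.
have [r kE] : exists r, k = r.*2 by exists k./2; rewrite even_halfK.
have [m NE] : exists m, N = (r + m).*2.
  by exists ((N - k)./2); rewrite kE doubleD even_halfK ?oddB -?kE ?(negbTE
    N_even) ?(negbTE k_even) // subnKC.
subst k N; rewrite (@pfaffian_alpha_beta_coef R r m p u v u_int).
rewrite (gen_partition_alt_pairs p_monic u_int v_int).
set X := alt_pairs _.
have -> : signpow ((r + m).*2%:R / 2 * ((r + m).*2%:R / 2 - 1) / 2) =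
  (-1) ^+ 'C(r + m, 2) :> R[i].
  have -> : (r + m).*2%:R / 2 = (r + m)%:R :> R.
    by rewrite -mul2n natrM mulrAC divff ?mul1r.
  by rewrite natr_bin2 signpow_nat.
rewrite dens_constE -/(gamma_const R (r + m).*2).
(* The right-hand side collects the normalisations of the partition function: 2^r r! from the
   chamber, 2^m from antisymmetrisation, m! from its definition. *)
have Efact : (2 ^ (r + m) * (r + m)`!)%:R^-1 * 'C(r + m, r)%:R =
    (2 ^ r)%:R^-1 * (2 ^ m)%:R^-1 * r`!%:R^-1 * m`!%:R^-1 :> R[i].
  have n0 n : n`!%:R != 0 :> R[i] by rewrite pnatr_eq0 -lt0n fact_gt0.
  have p0 n : (2 ^ n)%:R != 0 :> R[i] by rewrite pnatr_eq0 expn_eq0.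
  have bin0 : 'C(r + m, r)%:R != 0 :> R[i] by rewrite pnatr_eq0 -lt0n bin_gt0
    leq_addr.
  rewrite -(bin_fact (leq_addr m r)) addKn expnD !natrM !invfM.
  have cancel (b b' x y z t : R[i]) : b' * b = 1 ->
      x * y * (b' * (z * t)) * b = x * y * z * t.
    by move=> bb; transitivity (b' * b * (x * y * z * t));
      [ring|rewrite bb mul1r].
  by apply: cancel; rewrite mulVf.
rewrite !(mulrA _^-1 _%:R) Efact natrM invfM.
have -> : - ('i%C / 2) = - 'i%C * 2^-1 :> R[i] by rewrite mulNr.
rewrite exprMn exprVn -natrX.
have sqr_bin n : (-1) ^+ n * (-1) ^+ n = 1 :> R[i] by rewrite -expr2 sqrr_sign.
(* [c1] is (-1)^'C(m, 2), once from A_{k,N} and once from the interleaving, so it cancels; [c2], the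
   sign of the column reordering, stays. *)
have collect (c1 c2 t t2 x y L fr fm Z: R[i]) : c1 * c1 = 1 ->
  fm * (c1 * t * x * L * c1 * c2 * y * (x * fr * Z)) =
  c2 * L * (x * y * fr * fm * (t * x * Z)).
  move=> c11; transitivity (c1 * c1 * (c2 * L * (x * y * fr * fm * (t * x *
    Z)))).
    by ring.
  by rewrite c11 mul1r.
exact: collect.
Qed.
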